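(* Let $M$ be a graph manifold whose dual graph $\Gamma$ is a tree, and suppose that each Seifert block dual to an end vertex of the tree has at least one boundary torus that is a boundary component of $M$. If a Seifert block $M_v$ of $M$ has a faithful representation $\rho_0:\pi_1(M_v)\to\widetilde{\mathrm{SL}}(2,\mathbb{R})\times_{\mathbb{Z}}\mathbb{R}$ to the Seifert motion group, then $\rho_0$ can be extended to a representation $\rho:\pi_1(M)\to\widetilde{\mathrm{SL}}(2,\mathbb{R})\times_{\mathbb{Z}}\mathbb{R}$ of the whole graph manifold, i.e. $\rho|_{\pi_1(M_v)}=\rho_0$.
   Context: Graph manifolds. A graph manifold is a compact connected oriented irreducible 3-manifold (here possibly with boundary consisting of tori) all of whose JSJ pieces are Seifert fibered; these pieces are its Seifert blocks. The dual graph $\Gamma$ has one vertex per Seifert block and one edge per JSJ torus. By convention each block is a trivial circle bundle $F_v\times S^1$ over a compact orientable surface $F_v$ of genus greater than $1$, and the dual graph is simple with at least one edge. An end vertex of a tree is a vertex of valence one. For a block $M_v$, $\pi_1(M_v)$ is regarded as a subgroup of $\pi_1(M)$ via the inclusion (with compatible base points). Seifert motion group. Let $\widetilde{\mathrm{SL}}(2,\mathbb{R})$ be the universal cover of $\mathrm{PSL}(2,\mathbb{R})$, and let $\tilde k:\mathbb{R}\to\widetilde{\mathrm{SL}}(2,\mathbb{R})$ be the lift, with $\tilde k(0)=1$, of $k(r)=\pm\begin{pmatrix}\cos\pi r&-\sin\pi r\\ \sin\pi r&\cos\pi r\end{pmatrix}$. The Seifert motion group is $\widetilde{\mathrm{SL}}(2,\mathbb{R})\times_{\mathbb{Z}}\mathbb{R}:=(\widetilde{\mathrm{SL}}(2,\mathbb{R})\times\mathbb{R})/\{(\tilde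 k(n),-n):n\in\mathbb{Z}\}$. *)

(* Defs.v *)
From HB Require Import structures.
From mathcomp Require Import all_boot all_order all_algebra.
From mathcomp Require Import all_classical all_reals all_analysis.
From mathcomp Require Import generic_quotient homotopy ring lra.
Set Implicit Arguments.
Unset Strict Implicit.
Unset Printing Implicit Defensive.
Import Order.TTheory GRing.Theory Num.Theory.
Import numFieldNormedType.Exports numFieldTopology.Exports.
Local Open Scope classical_set_scope.
Local Open Scope ring_scope.
Local Open Scope quotient_scope.

Record setoidGroup (T : choiceType) := SetoidGroup {
  sg_eqv : T -> T -> Prop;
  sg_mul : T -> T -> T;
  sg_one : T;
  sg_inv : T -> T;
  sg_refl : forall a, sg_eqv a a;
  sg_sym : forall a b, sg_eqv a b -> sg_eqv b a;
  sg_trans : forall a b c, sg_eqv a b -> sg_eqv b c -> sg_eqv a c;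
  sg_mulE : forall a a' b b',
    sg_eqv a a' -> sg_eqv b b' -> sg_eqv (sg_mul a b) (sg_mul a' b');
  sg_invE : forall a a', sg_eqv a a' -> sg_eqv (sg_inv a) (sg_inv a');
  sg_mulA : forall a b c,
    sg_eqv (sg_mul a (sg_mul b c)) (sg_mul (sg_mul a b) c);
  sg_mul1 : forall a, sg_eqv (sg_mul sg_one a) a;
  sg_mulr1 : forall a, sg_eqv (sg_mul a sg_one) a;
  sg_mulV : forall a, sg_eqv (sg_mul (sg_inv a) a) sg_one;
  sg_mulrV : forall a, sg_eqv (sg_mul a (sg_inv a)) sg_one }.

Section QuotientGroup.
Context {T : choiceType} (S : setoidGroup T).

Definition sg_rel : rel T := fun a b => `[< sg_eqv S a b >].

Lemma sg_rel_refl : reflexive sg_rel.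
Proof. by move=> a; apply/asboolP; exact: sg_refl. Qed.
Lemma sg_rel_sym : symmetric sg_rel.
Proof. by move=> a b; apply/asboolP/asboolP; exact: sg_sym. Qed.
Lemma sg_rel_trans : transitive sg_rel.
Proof.
by move=> b a c /asboolP ab /asboolP bc; apply/asboolP; exact: sg_trans bc.
Qed.

Canonical sg_equiv_rel := EquivRel sg_rel sg_rel_refl sg_rel_sym sg_rel_trans.

Definition quotient_group : Type := {eq_quot sg_equiv_rel}.
HB.instance Definition _ := Choice.on quotient_group.
HB.instance Definition _ := Quotient.on quotient_group.

Definition qclass (a : T) : quotient_group := \pi_quotient_group a.

Lemma qclassP a b : qclass a = qclass b <-> sg_eqv S a b.
Proof.
by split=> [/eqmodP/asboolP|ab]; last apply/eqmodP/asboolP.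
Qed.

Lemma qclass_repr (x : quotient_group) : qclass (repr x) = x.
Proof. exact: reprK. Qed.

Lemma repr_qclass a : sg_eqv S (repr (qclass a)) a.
Proof. by apply/qclassP; rewrite qclass_repr. Qed.

Definition qmul (x y : quotient_group) := qclass (sg_mul S (repr x) (repr y)).
Definition qinv (x : quotient_group) := qclass (sg_inv S (repr x)).
Definition qone : quotient_group := qclass (sg_one S).

Lemma qmulE a b : qmul (qclass a) (qclass b) = qclass (sg_mul S a b).
Proof. by apply/qclassP; apply: sg_mulE; exact: repr_qclass. Qed.
Lemma qinvE a : qinv (qclass a) = qclass (sg_inv S a).
Proof. by apply/qclassP; apply: sg_invE; exact: repr_qclass. Qed.

Lemma qmulA : associative qmul.
Proof.
move=> x y z; rewrite -(qclass_repr x) -(qclass_repr y) -(qclass_repr z).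
by rewrite !qmulE; apply/qclassP; exact: sg_mulA.
Qed.
Lemma qmul1 : left_id qone qmul.
Proof.
by move=> x; rewrite -(qclass_repr x) qmulE; apply/qclassP; exact: sg_mul1.
Qed.
Lemma qmulr1 : right_id qone qmul.
Proof.
by move=> x; rewrite -(qclass_repr x) qmulE; apply/qclassP; exact: sg_mulr1.
Qed.
Lemma qmulV : left_inverse qone qinv qmul.
Proof.
move=> x; rewrite -(qclass_repr x) qinvE qmulE.
by apply/qclassP; exact: sg_mulV.
Qed.
Lemma qmulrV : right_inverse qone qinv qmul.
Proof.
move=> x; rewrite -(qclass_repr x) qinvE qmulE.
by apply/qclassP; exact: sg_mulrV.
Qed.

HB.instance Definition _ :=
  isGroup.Build quotient_group qmulA qmul1 qmulr1 qmulV qmulrV.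

Lemma qclassM a b : qclass (sg_mul S a b) = (qclass a * qclass b)%g.
Proof. by rewrite -qmulE. Qed.

End QuotientGroup.

Section Paste.
Context {R : realType} {Z X : topologicalType}.

Lemma paste_continuous (phi : Z -> R) (c : R) (f g : Z -> X) :
  continuous phi -> continuous f -> continuous g ->
  (forall z, phi z = c -> f z = g z) ->
  continuous (fun z => if phi z <= c then f z else g z).
Proof.
move=> cphi cf cg fg z U.
have [zc|cz|zc] := ltgtP (phi z) c => nU.
- have lc : \forall w \near z, phi w < c.
    apply: (cphi z [set y | y < c]); exact: lt_nbhsl.
  have nf : \forall w \near z, U (f w) by exact: (cf z U).
  by apply: filterS2 lc nf => w wc Uw /=; rewrite ltW.
- have lc : \forall w \near z, c < phi w.
    apply: (cphi z [set y | c < y]); exact: lt_nbhsr.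
  have nf : \forall w \near z, U (g w) by exact: (cg z U).
  by apply: filterS2 lc nf => w wc Uw /=; rewrite leNgt wc.
have nf : \forall w \near z, U (f w) by exact: (cf z U).
have ng : \forall w \near z, U (g w).
  by apply: (cg z U); rewrite -(fg z zc).
by apply: filterS2 nf ng => w fw gw /=; case: ifP.
Qed.

End Paste.

Lemma set_val_continuous (X : topologicalType) (A : set X) :
  continuous (set_val : A -> X).
Proof. exact: initial_continuous. Qed.

Lemma continuous_set_type (X Z : topologicalType) (A : set X) (f : Z -> A) :
  continuous (set_val \o f) -> continuous f.
Proof. exact: continuous_comp_initial. Qed.

Lemma continuous_pair (X Y Z : topologicalType) (f : Z -> X) (g : Z -> Y) :
  continuous f -> continuous g -> continuous (fun z => (f z, g z)).
Proof. by move=> cf cg z; apply: cvg_pair; [exact: cf|exact: cg]. Qed.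

Lemma continuous_fst (X Y : topologicalType) : continuous (@fst X Y).
Proof. by move=> p; exact: cvg_fst. Qed.
Lemma continuous_snd (X Y : topologicalType) : continuous (@snd X Y).
Proof. by move=> p; exact: cvg_snd. Qed.

Lemma continuous_compose (X Y Z : topologicalType) (g : Y -> Z) (f : X -> Y) :
  continuous g -> continuous f -> continuous (g \o f).
Proof. by move=> cg cf x; apply: continuous_comp; [exact: cf|exact: cg]. Qed.

Lemma continuousR_max (R : realType) (Z : topologicalType) (f g : Z -> R) :
  continuous f -> continuous g -> continuous (fun z => Num.max (f z) (g z)).
Proof. by move=> cf cg z; exact: (continuous_max (cf z) (cg z)). Qed.

Lemma continuousR_min (R : realType) (Z : topologicalType) (f g : Z -> R) :
  continuous f -> continuous g -> continuous (fun z => Num.min (f z) (g z)).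
Proof. by move=> cf cg z; exact: (continuous_min (cf z) (cg z)). Qed.

Section ContinuousArith.
Context {R : realType} {Z : topologicalType}.
Implicit Types f g : Z -> R.

Lemma continuousR_cst (c : R) : continuous (fun _ : Z => c).
Proof. exact: cst_continuous. Qed.
Lemma continuousR_add f g :
  continuous f -> continuous g -> continuous (fun z => f z + g z).
Proof. by move=> cf cg z; apply: cvgD; [exact: cf|exact: cg]. Qed.
Lemma continuousR_sub f g :
  continuous f -> continuous g -> continuous (fun z => f z - g z).
Proof. by move=> cf cg z; apply: cvgB; [exact: cf|exact: cg]. Qed.
Lemma continuousR_opp f : continuous f -> continuous (fun z => - f z).
Proof. by move=> cf z; apply: cvgN; exact: cf. Qed.
Lemma continuousR_mul f g :
  continuous f -> continuous g -> continuous (fun z => f z * g z).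
Proof. by move=> cf cg z; apply: cvgM; [exact: cf|exact: cg]. Qed.

End ContinuousArith.

Section UnitInterval.
Context {R : realType}.

Definition unitI : Type := set_type (`[0, 1]%classic : set R).
HB.instance Definition _ := Topological.on unitI.

Definition ival (s : unitI) : R := set_val s.

Lemma ival_bounds s : 0 <= ival s <= 1.
Proof.
have /= : `[0, 1]%classic (ival s) by exact: set_valP.
by rewrite in_itv.
Qed.

Lemma clamp_subproof (x : R) :
  Num.max 0 (Num.min x 1) \in (`[0, 1]%classic : set R).
Proof. by rewrite inE /= in_itv /= le_max lexx /= ge_max ler01 ge_min lexx orbT. Qed.

Definition clamp (x : R) : unitI :=
  exist (fun y : R => y \in (`[0, 1]%classic : set R)) _ (clamp_subproof x).

Lemma ival_clamp x : ival (clamp x) = Num.max 0 (Num.min x 1).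
Proof. by []. Qed.

Lemma clampK x : 0 <= x <= 1 -> ival (clamp x) = x.
Proof.
by move=> /andP[x0 x1]; rewrite ival_clamp (min_idPl x1) (max_idPr x0).
Qed.

Lemma ival_inj : injective ival.
Proof. exact: val_inj. Qed.

Lemma ivalK s : clamp (ival s) = s.
Proof. by apply: ival_inj; rewrite clampK // ival_bounds. Qed.

Lemma ival_continuous : continuous ival.
Proof. exact: set_val_continuous. Qed.

Lemma clamp_continuous : continuous clamp.
Proof.
apply: continuous_set_type => x.
have -> : set_val \o clamp = fun x => Num.max 0 (Num.min x 1) by [].
apply: continuousR_max; first exact: cst_continuous.
by apply: continuousR_min; [move=> y; exact: cvg_id|exact: cst_continuous].
Qed.

Lemma clamp01 : clamp 0 != clamp 1.
Proof.
apply/eqP => /(congr1 ival); rewrite !clampK ?lexx ?ler01 //.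
by move/eqP; rewrite eq_sym oner_eq0.
Qed.

HB.instance Definition _ := isBiPointed.Build unitI clamp01.

Lemma ival0 : ival zero = 0.
Proof. by rewrite clampK // lexx ler01. Qed.
Lemma ival1 : ival one = 1.
Proof. by rewrite clampK // lexx ler01. Qed.

End UnitInterval.
Arguments unitI R : clear implicits.

Section PathHomotopy.
Context {R : realType} {X : topologicalType}.
Local Notation I := (unitI R).
Implicit Types f g h : I -> X.

(* relative to the endpoints; the first variable is the time of the homotopy *)
Definition path_homotopic f g := exists H : I * I -> X,
  [/\ continuous H,
      forall t, H (zero, t) = f t /\ H (one, t) = g t &
      forall s, H (s, zero) = f zero /\ H (s, one) = f one].

Lemma path_homotopic_ends f g :
  path_homotopic f g -> f zero = g zero /\ f one = g one.
Proof.
by case=> H [_ Ht Hs]; rewrite -!(proj2 (Ht _)) !(proj1 (Hs _)) !(proj2 (Hs _)).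
Qed.

Lemma path_homotopic_refl f : continuous f -> path_homotopic f f.
Proof.
move=> cf; exists (f \o snd); split => //.
by apply: continuous_compose => //; exact: continuous_snd.
Qed.

Lemma path_homotopic_sym f g : path_homotopic f g -> path_homotopic g f.
Proof.
move=> fg; have [fg0 fg1] := path_homotopic_ends fg.
case: fg => H [cH Ht Hs].
exists (fun p => H (clamp (1 - ival p.1), p.2)); split.
- apply: (continuous_compose (g := H)) => //; apply: continuous_pair.
    apply: (continuous_compose (g := clamp)); first exact: clamp_continuous.
    apply: continuousR_sub; first exact: continuousR_cst.
    apply: (continuous_compose (g := ival)) => //; first exact: ival_continuous.
    exact: continuous_fst.
  exact: continuous_snd.
- by move=> t /=; rewrite ival0 ival1 subr0 subrr; have [] := Ht t.
- by move=> s /=; rewrite -fg0 -fg1.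
Qed.

Definition idouble (s : I) : I := clamp (2 * ival s).
Definition idouble1 (s : I) : I := clamp (2 * ival s - 1).

Lemma idouble_continuous : continuous idouble.
Proof.
apply: (continuous_compose (g := clamp)); first exact: clamp_continuous.
by apply: continuousR_mul; [exact: continuousR_cst|exact: ival_continuous].
Qed.
Lemma idouble1_continuous : continuous idouble1.
Proof.
apply: (continuous_compose (g := clamp)); first exact: clamp_continuous.
apply: continuousR_sub; last exact: continuousR_cst.
by apply: continuousR_mul; [exact: continuousR_cst|exact: ival_continuous].
Qed.

Lemma idouble_half s : ival s = 2^-1 -> idouble s = one.
Proof. by rewrite /idouble => ->; rewrite divff. Qed.
Lemma idouble1_half s : ival s = 2^-1 -> idouble1 s = zero.
Proof. by rewrite /idouble1 => ->; rewrite divff // subrr. Qed.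
Lemma idouble0 : idouble zero = zero.
Proof. by rewrite /idouble ival0 mulr0. Qed.
Lemma idouble1_1 : idouble1 one = one.
Proof. by rewrite /idouble1 ival1 mulr1; congr clamp; ring. Qed.

Lemma path_homotopic_trans f g h :
  path_homotopic f g -> path_homotopic g h -> path_homotopic f h.
Proof.
move=> fg gh; have [fg0 fg1] := path_homotopic_ends fg.
have [gh0 gh1] := path_homotopic_ends gh.
case: fg gh => H [cH Ht Hs] [K [cK Kt Ks]].
exists (fun p => if ival p.1 <= 2^-1 then H (idouble p.1, p.2)
                 else K (idouble1 p.1, p.2)); split.
- apply: (@paste_continuous _ _ _ (fun p => ival p.1) _
    (fun p => H (idouble p.1, p.2)) (fun p => K (idouble1 p.1, p.2))).
  + apply: (continuous_compose (g := ival)); first exact: ival_continuous.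
    exact: continuous_fst.
  + apply: (continuous_compose (g := H)) => //; apply: continuous_pair.
      apply: (continuous_compose (g := idouble)).
        exact: idouble_continuous.
      exact: continuous_fst.
    exact: continuous_snd.
  + apply: (continuous_compose (g := K)) => //; apply: continuous_pair.
      apply: (continuous_compose (g := idouble1)).
        exact: idouble1_continuous.
      exact: continuous_fst.
    exact: continuous_snd.
  + move=> p p12; rewrite idouble_half // idouble1_half //.
    by rewrite (proj2 (Ht _)) (proj1 (Kt _)).
- move=> t /=; rewrite ival0 ival1 invr_ge0 ler0n idouble0 idouble1_1.
  rewrite (_ : (1 <= 2^-1 :> R) = false); last by apply/negbTE; rewrite -ltNge; lra.
  by split; [exact: (proj1 (Ht t))|exact: (proj2 (Kt t))].
- move=> s /=; case: ifP => _; first exact: Hs.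
  by rewrite fg0 fg1; exact: Ks.
Qed.

Definition path_concat f g : I -> X :=
  fun t => if ival t <= 2^-1 then f (idouble t) else g (idouble1 t).

Lemma path_concat_continuous f g : continuous f -> continuous g ->
  f one = g zero -> continuous (path_concat f g).
Proof.
move=> cf cg fg.
apply: (@paste_continuous _ _ _ ival _ (f \o idouble) (g \o idouble1)).
- exact: ival_continuous.
- by apply: continuous_compose => //; exact: idouble_continuous.
- by apply: continuous_compose => //; exact: idouble1_continuous.
- by move=> t th /=; rewrite idouble_half // idouble1_half.
Qed.

Lemma path_concat0 f g : path_concat f g zero = f zero.
Proof. by rewrite /path_concat ival0 invr_ge0 ler0n idouble0. Qed.

Lemma path_concat1 f g : path_concat f g one = g one.
Proof.
rewrite /path_concat ival1 idouble1_1.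
rewrite (_ : (1 <= 2^-1 :> R) = false) //.
by apply/negbTE; rewrite -ltNge; lra.
Qed.

Lemma path_homotopic_concat f f' g g' : f one = g zero ->
  path_homotopic f f' -> path_homotopic g g' ->
  path_homotopic (path_concat f g) (path_concat f' g').
Proof.
move=> fg [H [cH Ht Hs]] [K [cK Kt Ks]].
exists (fun p => if ival p.2 <= 2^-1 then H (p.1, idouble p.2)
                 else K (p.1, idouble1 p.2)); split.
- apply: (@paste_continuous _ _ _ (fun p => ival p.2) _
    (fun p => H (p.1, idouble p.2)) (fun p => K (p.1, idouble1 p.2))).
  + apply: (continuous_compose (g := ival)); first exact: ival_continuous.
    exact: continuous_snd.
  + apply: (continuous_compose (g := H)) => //; apply: continuous_pair.
      exact: continuous_fst.
    apply: (continuous_compose (g := idouble)); first exact: idouble_continuous.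
    exact: continuous_snd.
  + apply: (continuous_compose (g := K)) => //; apply: continuous_pair.
      exact: continuous_fst.
    apply: (continuous_compose (g := idouble1)); first exact: idouble1_continuous.
    exact: continuous_snd.
  + move=> p p12; rewrite idouble_half // idouble1_half //.
    by rewrite (proj2 (Hs _)) (proj1 (Ks _)).
- by move=> t; rewrite /path_concat /=; case: ifP => _; [exact: Ht|exact: Kt].
- move=> s /=; rewrite path_concat0 path_concat1 ival0 ival1 invr_ge0 ler0n.
  rewrite (_ : (1 <= 2^-1 :> R) = false); last by apply/negbTE; rewrite -ltNge; lra.
  by rewrite idouble0 idouble1_1; split; [exact: (proj1 (Hs s))|exact: (proj2 (Ks s))].
Qed.

Lemma path_homotopic_reparam f (u v : I -> I) :
  continuous f -> continuous u -> continuous v ->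
  u zero = v zero -> u one = v one ->
  path_homotopic (f \o u) (f \o v).
Proof.
move=> cf cu cv uv0 uv1.
exists (fun p => f (clamp ((1 - ival p.1) * ival (u p.2) + ival p.1 * ival (v p.2)))).
split.
- apply: (continuous_compose (g := f)) => //.
  apply: (continuous_compose (g := clamp)); first exact: clamp_continuous.
  have c1 : continuous (fun p : I * I => ival p.1).
    apply: (continuous_compose (g := ival)); first exact: ival_continuous.
    exact: continuous_fst.
  have c2 w : continuous w -> continuous (fun p : I * I => ival (w p.2)).
    move=> cw; apply: (continuous_compose (g := ival)); first exact: ival_continuous.
    by apply: (continuous_compose (g := w)) => //; exact: continuous_snd.
  apply: continuousR_add; apply: continuousR_mul.
  + by apply: continuousR_sub; [exact: continuousR_cst|exact: c1].
  + exact: c2.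
  + exact: c1.
  + exact: c2.
- move=> t /=; rewrite ival0 ival1 subr0 subrr !mul1r !mul0r add0r addr0.
  by rewrite !ivalK.
- move=> s /=; rewrite -uv0 -uv1 -!mulrDl subrK !mul1r.
  by rewrite !ivalK.
Qed.

Lemma path_homotopic_reparam_id f (u : I -> I) :
  continuous f -> continuous u -> u zero = zero -> u one = one ->
  path_homotopic (f \o u) f.
Proof.
move=> cf cu u0 u1; apply: (@path_homotopic_reparam f u id) => //.
by move=> y; exact: cvg_id.
Qed.

End PathHomotopy.

Section FundamentalGroup.
Context {R : realType} {X : topologicalType} (x : X).
Local Notation I := (unitI R).
Local Notation loop := {path I from x to x in X}.

Lemma loop_mul_continuous (f g : loop) : continuous (path_concat f g).
Proof.
by apply: path_concat_continuous; [exact: cts_fun..|rewrite path_zero path_one].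
Qed.
Lemma loop_mul0 (f g : loop) : path_concat f g zero = x.
Proof. by rewrite path_concat0 path_zero. Qed.
Lemma loop_mul1 (f g : loop) : path_concat f g one = x.
Proof. by rewrite path_concat1 path_one. Qed.

Definition loop_mul (f g : loop) : loop :=
  mk_path (@loop_mul_continuous f g) (loop_mul0 f g) (loop_mul1 f g).

Definition irev (t : I) : I := clamp (1 - ival t).

Lemma irev_continuous : continuous irev.
Proof.
apply: (continuous_compose (g := clamp)); first exact: clamp_continuous.
by apply: continuousR_sub; [exact: continuousR_cst|exact: ival_continuous].
Qed.

Lemma irev_zero : irev zero = one. Proof. by rewrite /irev ival0 subr0. Qed.
Lemma irev_one : irev one = zero. Proof. by rewrite /irev ival1 subrr. Qed.

Lemma loop_inv_continuous (f : loop) : continuous (f \o irev).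
Proof.
by apply: continuous_compose; [exact: cts_fun|exact: irev_continuous].
Qed.
Lemma loop_inv0 (f : loop) : (f \o irev) zero = x.
Proof. by rewrite /= irev_zero path_one. Qed.
Lemma loop_inv1 (f : loop) : (f \o irev) one = x.
Proof. by rewrite /= irev_one path_zero. Qed.

Definition loop_inv (f : loop) : loop :=
  mk_path (@loop_inv_continuous f) (loop_inv0 f) (loop_inv1 f).

Definition loop_one : loop := cst x : I -> X.

Let lift (u : R -> R) (t : I) : I := clamp (u (ival t)).
Let lift_continuous u : continuous (u : R -> R) -> continuous (lift u).
Proof.
move=> cu; apply: (continuous_compose (g := clamp)); first exact: clamp_continuous.
by apply: (continuous_compose (g := u)) => //; exact: ival_continuous.
Qed.

Let idR_continuous : continuous (id : R -> R).
Proof. by move=> y; exact: cvg_id. Qed.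

Lemma loop_mulE (f f' g g' : loop) :
  path_homotopic f f' -> path_homotopic g g' ->
  path_homotopic (loop_mul f g) (loop_mul f' g').
Proof. by apply: path_homotopic_concat; rewrite path_one path_zero. Qed.

Lemma loop_invE (f g : loop) :
  path_homotopic f g -> path_homotopic (loop_inv f) (loop_inv g).
Proof.
move=> [H [cH Ht Hs]]; exists (fun p => H (p.1, irev p.2)); split.
- apply: (continuous_compose (g := H)) => //; apply: continuous_pair.
    exact: continuous_fst.
  apply: (continuous_compose (g := irev)); first exact: irev_continuous.
  exact: continuous_snd.
- by move=> t; exact: Ht.
- move=> s /=; rewrite irev_zero irev_one !path_zero !path_one.
  by rewrite (proj1 (Hs s)) (proj2 (Hs s)) path_zero path_one.
Qed.

Lemma loop_mulA (f g h : loop) :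
  path_homotopic (loop_mul f (loop_mul g h)) (loop_mul (loop_mul f g) h).
Proof.
pose u := fun y : R => Num.max (y / 2) (Num.max (y - 4^-1) (2 * y - 1)).
have cu : continuous u.
  have cid := idR_continuous.
  apply: continuousR_max.
    by apply: continuousR_mul => //; exact: continuousR_cst.
  apply: continuousR_max.
    by apply: continuousR_sub => //; exact: continuousR_cst.
  apply: continuousR_sub; last exact: continuousR_cst.
  by apply: continuousR_mul => //; exact: continuousR_cst.
have -> : loop_mul f (loop_mul g h) = loop_mul (loop_mul f g) h \o lift u
    :> (I -> X).
  apply/funext => t; rewrite /= /mk_path /path_concat /= /mk_path /path_concat.
  rewrite /lift /u /idouble /idouble1.
  have /andP[t0 t1] := ival_bounds t; move: (ival t) t0 t1 => {}t t0 t1.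
  have [th|th] := leP t 2^-1.
    have E : Num.max (t / 2) (Num.max (t - 4^-1) (2 * t - 1)) = t / 2.
      by apply/max_idPl; rewrite ge_max; apply/andP; split; lra.
    rewrite E !clampK; try by apply/andP; split; lra.
    rewrite ifT; last lra.
    rewrite ifT; last lra.
    by congr (f (clamp _)); lra.
  have [th'|th'] := leP t (3 / 4).
    have E : Num.max (t / 2) (Num.max (t - 4^-1) (2 * t - 1)) = t - 4^-1.
      rewrite (_ : Num.max (t - 4^-1) (2 * t - 1) = t - 4^-1); last first.
        by apply/max_idPl; lra.
      by apply/max_idPr; lra.
    rewrite E !clampK; try by apply/andP; split; lra.
    rewrite ifT; last lra.
    rewrite ifT; last lra.
    rewrite ifF; last by apply/negbTE; rewrite -ltNge; lra.
    by congr (g (clamp _)); lra.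
  have E : Num.max (t / 2) (Num.max (t - 4^-1) (2 * t - 1)) = 2 * t - 1.
    rewrite (_ : Num.max (t - 4^-1) (2 * t - 1) = 2 * t - 1); last first.
      by apply/max_idPr; lra.
    by apply/max_idPr; lra.
  rewrite E (@clampK _ (2 * t - 1)); last by apply/andP; split; lra.
  rewrite ifF; last by apply/negbTE; rewrite -ltNge; lra.
  rewrite ifF; last by apply/negbTE; rewrite -ltNge; lra.
  by congr (h (clamp _)); lra.
apply: path_homotopic_reparam_id; first exact: cts_fun.
- exact: lift_continuous.
- rewrite /lift ival0 /u (_ : Num.max _ _ = 0 :> R) //.
  by rewrite mul0r mulr0 !sub0r max_l // ge_max; apply/andP; split; lra.
- rewrite /lift ival1 /u (_ : Num.max _ _ = 1 :> R) //.
  rewrite mulr1 (_ : Num.max (1 - 4^-1) _ = 1 :> R) ?max_r //; try lra.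
Qed.

Lemma loop_mul1p (f : loop) : path_homotopic (loop_mul loop_one f) f.
Proof.
have -> : loop_mul loop_one f = f \o idouble1 :> (I -> X).
  apply/funext => t; rewrite /= /mk_path /path_concat /=; case: ifP => // th.
  rewrite -[LHS](@path_zero _ _ _ _ f); congr (f _); apply: ival_inj.
  rewrite ival0 /idouble1 ival_clamp; apply/esym/max_idPl.
  by rewrite ge_min; apply/orP; left; lra.
apply: path_homotopic_reparam_id; first exact: cts_fun.
- exact: idouble1_continuous.
- rewrite /idouble1 ival0; apply: ival_inj; rewrite ival_clamp ival0.
  by apply/max_idPl; rewrite ge_min; apply/orP; left; lra.
- exact: idouble1_1.
Qed.

Lemma loop_mulp1 (f : loop) : path_homotopic (loop_mul f loop_one) f.
Proof.
have -> : loop_mul f loop_one = f \o idouble :> (I -> X).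
  apply/funext => t; rewrite /= /mk_path /path_concat /=; case: ifP => // /negbT.
  rewrite -ltNge => th; rewrite -[LHS](@path_one _ _ _ _ f); congr (f _).
  rewrite /idouble; apply: ival_inj; rewrite ival1 ival_clamp.
  by rewrite (min_idPr _) ?(max_idPr _) //; lra.
apply: path_homotopic_reparam_id; first exact: cts_fun.
- exact: idouble_continuous.
- exact: idouble0.
- rewrite /idouble ival1; apply: ival_inj.
  by rewrite ival1 ival_clamp (min_idPr _) ?(max_idPr _) //; lra.
Qed.

Lemma loop_mulpV (f : loop) : path_homotopic (loop_mul f (loop_inv f)) loop_one.
Proof.
pose u := fun y : R => Num.min (2 * y) (2 - 2 * y).
have cu : continuous u.
  have cid := idR_continuous.
  have c2 : continuous (fun y : R => 2 * y).
    by apply: continuousR_mul => //; exact: continuousR_cst.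
  apply: continuousR_min => //.
  by apply: continuousR_sub => //; exact: continuousR_cst.
have -> : loop_mul f (loop_inv f) = f \o lift u :> (I -> X).
  apply/funext => t; rewrite /= /mk_path /path_concat /= /irev /lift /u.
  rewrite /idouble /idouble1.
  have /andP[t0 t1] := ival_bounds t; move: (ival t) t0 t1 => {}t t0 t1.
  have [th|th] := leP t 2^-1.
    by congr (f (clamp _)); apply/esym/min_idPl; lra.
  rewrite clampK; last by apply/andP; split; lra.
  congr (f (clamp _)); rewrite (min_idPr _); lra.
have -> : (loop_one : I -> X) = (f : I -> X) \o (fun=> zero).
  by apply/funext => t /=; rewrite path_zero.
apply: path_homotopic_reparam => //; first exact: cts_fun.
- exact: lift_continuous.
- exact: cst_continuous.
- rewrite /lift /u ival0; apply: ival_inj; rewrite ival0.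
  by rewrite (min_idPl _) ?mulr0 ?clampK ?lexx ?ler01 //; lra.
- rewrite /lift /u ival1; apply: ival_inj; rewrite ival0.
  by rewrite mulr1 subrr (min_idPr _) ?clampK ?lexx ?ler01 //; lra.
Qed.

Lemma loop_mulVp (f : loop) : path_homotopic (loop_mul (loop_inv f) f) loop_one.
Proof.
have -> : loop_mul (loop_inv f) f = loop_mul (loop_inv f) (loop_inv (loop_inv f))
    :> (I -> X).
  apply/funext => t; rewrite /= /mk_path /path_concat; case: ifP => // _ /=.
  congr (f _); apply: ival_inj; rewrite /irev.
  have /andP[t0 t1] := ival_bounds (idouble1 t).
  move: (idouble1 t) t0 t1 => y y0 y1.
  rewrite !clampK; first (by ring); by apply/andP; split; rewrite ?clampK; lra.
exact: loop_mulpV.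
Qed.

Definition loop_setoidGroup : setoidGroup loop := {|
  sg_eqv := fun f g : loop => path_homotopic f g;
  sg_mul := loop_mul;
  sg_one := loop_one;
  sg_inv := loop_inv;
  sg_refl := fun f => path_homotopic_refl (@cts_fun _ _ f);
  sg_sym := fun f g => @path_homotopic_sym _ _ f g;
  sg_trans := fun f g h => @path_homotopic_trans _ _ f g h;
  sg_mulE := loop_mulE;
  sg_invE := loop_invE;
  sg_mulA := loop_mulA;
  sg_mul1 := loop_mul1p;
  sg_mulr1 := loop_mulp1;
  sg_mulV := loop_mulVp;
  sg_mulrV := loop_mulpV |}.

Definition pi1 : Type := quotient_group loop_setoidGroup.
HB.instance Definition _ := Group.on pi1.

Definition pi1_class (f : loop) : pi1 := qclass loop_setoidGroup f.

End FundamentalGroup.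
Arguments pi1 R {X} x.

Section InducedMap.
Context {R : realType} {X Y : topologicalType}.
Local Notation I := (unitI R).

Definition pi1_map (f : continuousType X Y) (x : X) (c : pi1 R x) : pi1 R (f x) :=
  pi1_class (f \o (repr c : {path I from x to x in X}) : {path I from f x to f x in Y}).

End InducedMap.

Section InducedMap2.
Context {R : realType} {X Y : topologicalType}.
Local Notation I := (unitI R).

Lemma pi1_map_class (f : continuousType X Y) (x : X)
    (p : {path I from x to x in X}) :
  pi1_map f (pi1_class p) =
  pi1_class (f \o p : {path I from f x to f x in Y}).
Proof.
apply/qclassP; case: (repr_qclass (loop_setoidGroup x) p) => H [cH Ht Hs].
exists (f \o H); split.
- by apply: continuous_compose => //; exact: cts_fun.
- by move=> t; split => /=; congr (f _); [exact: (proj1 (Ht t))|exact: (proj2 (Ht t))].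
- by move=> s; split => /=; congr (f _); [exact: (proj1 (Hs s))|exact: (proj2 (Hs s))].
Qed.

Lemma pi1_mapM (f : continuousType X Y) (x : X) :
  {morph @pi1_map R X Y f x : c d / (c * d)%g >-> (c * d)%g}.
Proof.
move=> c d; rewrite -(qclass_repr c) -(qclass_repr d) -qclassM.
rewrite !pi1_map_class -[RHS]qclassM; congr (qclass _ _).
apply/path_eqP => t; rewrite /= /mk_path /path_concat /=.
by case: ifP.
Qed.

End InducedMap2.

Definition set_incl {X : topologicalType} (A : set X) : A -> X := set_val.
HB.instance Definition _ (X : topologicalType) (A : set X) :=
  @isContinuous.Build A X (@set_incl X A) (@set_val_continuous X A).

HB.mixin Record isTopologicalGroup G & Group G & Topological G := {
  mulg_continuous : continuous (fun p : G * G => (p.1 * p.2)%g);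
  invg_continuous : continuous (fun a : G => a^-1%g) }.

#[short(type="topologicalGroupType")]
HB.structure Definition TopologicalGroup :=
  {G of isTopologicalGroup G & Group G & Topological G}.

Section UniversalCover.
Context {R : realType} (G : topologicalGroupType).
Local Notation I := (unitI R).

Record based_path := BasedPath {
  bpath :> I -> G;
  bpath_continuous : continuous bpath;
  bpath0 : bpath zero = 1%g }.

HB.instance Definition _ := gen_eqMixin based_path.
HB.instance Definition _ := gen_choiceMixin based_path.

Implicit Types f g h : based_path.

Lemma continuousG_mul (Z : topologicalType) (f g : Z -> G) : continuous f -> continuous g ->
  continuous (fun t => f t * g t)%g.
Proof.
move=> cf cg; apply: (@continuous_compose _ _ _ (fun p : G * G => (p.1 * p.2)%g)
  (fun t => (f t, g t))); first exact: mulg_continuous.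
exact: continuous_pair.
Qed.

Lemma continuousG_inv (Z : topologicalType) (f : Z -> G) :
  continuous f -> continuous (fun t => (f t)^-1)%g.
Proof.
move=> cf; apply: (@continuous_compose _ _ _ (fun a : G => a^-1%g) f) => //.
exact: invg_continuous.
Qed.

Program Definition bp_mul f g : based_path :=
  @BasedPath (fun t => f t * g t)%g _ _.
Next Obligation.
by move=> f g; apply: continuousG_mul; exact: bpath_continuous.
Qed.
Next Obligation. by move=> f g /=; rewrite !bpath0 mulg1. Qed.

Program Definition bp_inv f : based_path := @BasedPath (fun t => (f t)^-1)%g _ _.
Next Obligation.
by move=> f; apply: continuousG_inv; exact: bpath_continuous.
Qed.
Next Obligation. by move=> f /=; rewrite bpath0 invg1. Qed.

Program Definition bp_one : based_path := @BasedPath (fun=> 1)%g _ _.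
Next Obligation. exact: cst_continuous. Qed.
Next Obligation. by []. Qed.

Lemma bpath_ext f g : f =1 g -> path_homotopic f g.
Proof.
move=> fg; have -> : (f : I -> G) = g by apply/funext.
by apply: path_homotopic_refl; exact: bpath_continuous.
Qed.

Lemma bp_mulE f f' g g' : path_homotopic f f' -> path_homotopic g g' ->
  path_homotopic (bp_mul f g) (bp_mul f' g').
Proof.
move=> [H [cH Ht Hs]] [K [cK Kt Ks]]; exists (fun p => H p * K p)%g; split.
- exact: continuousG_mul.
- by move=> t /=; have [-> ->] := Ht t; have [-> ->] := Kt t.
- by move=> s /=; have [-> ->] := Hs s; have [-> ->] := Ks s.
Qed.

Lemma bp_invE f f' : path_homotopic f f' ->
  path_homotopic (bp_inv f) (bp_inv f').
Proof.
move=> [H [cH Ht Hs]]; exists (fun p => (H p)^-1)%g; split.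
- exact: continuousG_inv.
- by move=> t /=; have [-> ->] := Ht t.
- by move=> s /=; have [-> ->] := Hs s.
Qed.

Program Definition bp_setoidGroup : setoidGroup based_path := {|
  sg_eqv := fun f g => path_homotopic f g;
  sg_mul := bp_mul;
  sg_one := bp_one;
  sg_inv := bp_inv;
  sg_refl := fun f => path_homotopic_refl (@bpath_continuous f);
  sg_sym := fun f g => @path_homotopic_sym _ _ f g;
  sg_trans := fun f g h => @path_homotopic_trans _ _ f g h;
  sg_mulE := bp_mulE;
  sg_invE := bp_invE |}.
Next Obligation. by move=> f g h; apply: bpath_ext => t /=; rewrite mulgA. Qed.
Next Obligation. by move=> f; apply: bpath_ext => t /=; rewrite mul1g. Qed.
Next Obligation. by move=> f; apply: bpath_ext => t /=; rewrite mulg1. Qed.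
Next Obligation. by move=> f; apply: bpath_ext => t /=; rewrite mulVg. Qed.
Next Obligation. by move=> f; apply: bpath_ext => t /=; rewrite mulgV. Qed.

(* Paths from 1 modulo homotopy relative to the endpoints, with pointwise      *)
(* product: the standard model of the universal cover of a connected group.   *)
Definition universal_cover : Type := quotient_group bp_setoidGroup.
HB.instance Definition _ := Group.on universal_cover.

Definition cover_class (f : based_path) : universal_cover :=
  qclass bp_setoidGroup f.

Lemma cover_loop_central f (x : universal_cover) : f one = 1%g ->
  (cover_class f * x = x * cover_class f)%g.
Proof.
move=> f1; rewrite -(qclass_repr x) -!qclassM; move: (repr x) => g.
pose g' (p : I * I) : G := g (clamp (ival p.1 * ival p.2)).
have cg' : continuous g'.
  apply: (continuous_compose (g := g)); first exact: bpath_continuous.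
  apply: (continuous_compose (g := clamp)); first exact: clamp_continuous.
  by apply: continuousR_mul; apply: (continuous_compose (g := ival));
    [exact: ival_continuous|exact: continuous_fst
    |exact: ival_continuous|exact: continuous_snd].
have cf2 (h : based_path) : continuous (fun p : I * I => h p.2).
  apply: (continuous_compose (g := h)); first exact: bpath_continuous.
  exact: continuous_snd.
apply/qclassP; exists (fun p => g' p * f p.2 * (g' p)^-1 * g p.2)%g; split.
- apply: continuousG_mul => //; apply: continuousG_mul; last exact: continuousG_inv.
  by apply: continuousG_mul.
- move=> t; rewrite /g' /= ival0 ival1 mul0r mul1r ivalK.
  by rewrite -[clamp 0]/zero bpath0 invg1 mul1g mulg1 mulgVK.
- move=> s; rewrite /g' /= ival0 ival1 mulr0 mulr1 ivalK.
  rewrite -[clamp 0]/zero !bpath0 f1 invg1 !mulg1 mul1g.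
  by rewrite mulgV mul1g.
Qed.

End UniversalCover.

Section PSL2.
Context {R : realType}.

Definition SL2 : Type := set_type [set A : 'M[R]_2 | \det A = 1].
HB.instance Definition _ := Topological.on SL2.

Definition SL2_mx (a : SL2) : 'M[R]_2 := set_val a.

Lemma SL2_det a : \det (SL2_mx a) = 1.
Proof. exact: (set_valP a). Qed.

Definition mkSL2 (A : 'M[R]_2) (A1 : \det A = 1) : SL2 :=
  exist (fun B : 'M[R]_2 => B \in [set A : 'M[R]_2 | \det A = 1]) A (mem_set A1).

Lemma SL2_inj : injective SL2_mx. Proof. exact: val_inj. Qed.

Lemma SL2_mul_subproof a b : \det (SL2_mx a *m SL2_mx b) = 1.
Proof. by rewrite det_mulmx !SL2_det mulr1. Qed.
Definition SL2_mul a b := mkSL2 (SL2_mul_subproof a b).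

Lemma SL2_unit a : SL2_mx a \in unitmx.
Proof. by rewrite unitmxE SL2_det unitr1. Qed.

Lemma SL2_inv_subproof a : \det (invmx (SL2_mx a)) = 1.
Proof. by rewrite det_inv SL2_det invr1. Qed.
Definition SL2_inv a := mkSL2 (SL2_inv_subproof a).

Definition SL2_one := mkSL2 (det1 R 2).

Lemma SL2_opp_subproof a : \det (- SL2_mx a) = 1.
Proof. by rewrite -scaleN1r detZ SL2_det mulr1 expr2 mulrNN mulr1. Qed.
Definition SL2_opp a := mkSL2 (SL2_opp_subproof a).

Lemma SL2_mxK (A : 'M[R]_2) (A1 : \det A = 1) : SL2_mx (mkSL2 A1) = A.
Proof. by []. Qed.
Arguments SL2_mx : simpl never.
Lemma SL2_mxM a b : SL2_mx (SL2_mul a b) = SL2_mx a *m SL2_mx b. Proof. by []. Qed.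
Lemma SL2_mxV a : SL2_mx (SL2_inv a) = invmx (SL2_mx a). Proof. by []. Qed.
Lemma SL2_mxN a : SL2_mx (SL2_opp a) = - SL2_mx a. Proof. by []. Qed.
Lemma SL2_mx1 : SL2_mx SL2_one = 1%:M. Proof. by []. Qed.
Definition SL2_mxE := (SL2_mxM, SL2_mxV, SL2_mxN, SL2_mx1).

Definition SL2_eqv a b := SL2_mx a = SL2_mx b \/ SL2_mx a = - SL2_mx b.

Program Definition PSL2_setoidGroup : setoidGroup SL2 := {|
  sg_eqv := SL2_eqv;
  sg_mul := SL2_mul;
  sg_one := SL2_one;
  sg_inv := SL2_inv |}.
Next Obligation. by move=> a; left. Qed.
Next Obligation.
by move=> a b [ab|ab]; [left|right]; rewrite ?ab ?opprK.
Qed.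
Next Obligation.
by move=> a b c [ab|ab] [bc|bc]; rewrite /SL2_eqv ab bc ?opprK; [left|right|right|left].
Qed.
Next Obligation.
move=> a a' b b' [ab|ab] [bc|bc]; rewrite /SL2_eqv !SL2_mxE ab bc.
- by left.
- by right; rewrite mulmxN.
- by right; rewrite mulNmx.
- by left; rewrite mulmxN mulNmx opprK.
Qed.
Next Obligation.
move=> a a' [ab|ab]; rewrite /SL2_eqv !SL2_mxE ab; first by left.
right; rewrite -[in LHS]scaleN1r invmxZ; last first.
  by rewrite unitmxE detZ SL2_det mulr1 expr2 mulrNN mulr1 unitr1.
by rewrite invrN invr1 scaleN1r.
Qed.
Next Obligation. by move=> a b c; left; rewrite !SL2_mxE mulmxA. Qed.
Next Obligation. by move=> a; left; rewrite !SL2_mxE mul1mx. Qed.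
Next Obligation. by move=> a; left; rewrite !SL2_mxE mulmx1. Qed.
Next Obligation. by move=> a; left; rewrite !SL2_mxE mulVmx // SL2_unit. Qed.
Next Obligation. by move=> a; left; rewrite !SL2_mxE mulmxV // SL2_unit. Qed.

Definition PSL2 : Type := quotient_topology (quotient_group PSL2_setoidGroup).
HB.instance Definition _ :=
  Topological.copy PSL2 (quotient_topology (quotient_group PSL2_setoidGroup)).
HB.instance Definition _ := isGroup.Build PSL2
  (@qmulA _ PSL2_setoidGroup) (@qmul1 _ PSL2_setoidGroup)
  (@qmulr1 _ PSL2_setoidGroup) (@qmulV _ PSL2_setoidGroup)
  (@qmulrV _ PSL2_setoidGroup).

Definition PSL2_class (a : SL2) : PSL2 := qclass PSL2_setoidGroup a.

Lemma PSL2_classM a b :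
  PSL2_class (SL2_mul a b) = (PSL2_class a * PSL2_class b)%g.
Proof. exact: (qclassM PSL2_setoidGroup a b). Qed.
Lemma PSL2_classV a : PSL2_class (SL2_inv a) = (PSL2_class a)^-1%g.
Proof. exact: (esym (qinvE PSL2_setoidGroup a)). Qed.
Lemma PSL2_classP a b : PSL2_class a = PSL2_class b <-> SL2_eqv a b.
Proof. exact: (qclassP PSL2_setoidGroup a b). Qed.
Lemma PSL2_surj (x : PSL2) : exists a, x = PSL2_class a.
Proof.
exists (repr (x : quotient_group PSL2_setoidGroup)).
exact: (esym (qclass_repr _)).
Qed.

Lemma PSL2_class_continuous : continuous PSL2_class.
Proof. exact: pi_continuous. Qed.

Lemma continuous_SL2 (Z : topologicalType) (f : Z -> SL2) :
  (forall i j, continuous (fun z => SL2_mx (f z) i j)) -> continuous f.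
Proof.
move=> cf; apply: continuous_set_type => z U [P nP sPU].
have near_P : \forall w \near z, forall i j, P i j (SL2_mx (f w) i j).
  apply: filter_forall => i; apply: filter_forall => j.
  exact: (cf i j z _ (nP i j)).
by apply: filterS near_P => w Pw; exact: sPU.
Qed.

Lemma SL2_coord_continuous i j : continuous (fun a : SL2 => SL2_mx a i j).
Proof.
apply: (@continuous_compose _ _ _ (fun M : 'M[R]_2 => M i j) SL2_mx).
  exact: coord_continuous.
exact: set_val_continuous.
Qed.

Lemma SL2_mul_continuous : continuous (fun p : SL2 * SL2 => SL2_mul p.1 p.2).
Proof.
apply: continuous_SL2 => i j.
have -> : (fun p : SL2 * SL2 => SL2_mx (SL2_mul p.1 p.2) i j) =
   fun p => SL2_mx p.1 i ord0 * SL2_mx p.2 ord0 j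
     + SL2_mx p.1 i (lift ord0 ord0) * SL2_mx p.2 (lift ord0 ord0) j.
  by apply/funext => p; rewrite SL2_mxE mxE !big_ord_recl big_ord0 addr0.
have c1 k l : continuous (fun p : SL2 * SL2 => SL2_mx p.1 k l).
  apply: (@continuous_compose _ _ _ (fun a => SL2_mx a k l) fst).
    exact: SL2_coord_continuous.
  exact: continuous_fst.
have c2 k l : continuous (fun p : SL2 * SL2 => SL2_mx p.2 k l).
  apply: (@continuous_compose _ _ _ (fun a => SL2_mx a k l) snd).
    exact: SL2_coord_continuous.
  exact: continuous_snd.
by apply: continuousR_add; apply: continuousR_mul.
Qed.

Lemma SL2_inv_adj a i j : SL2_mx (SL2_inv a) i j = cofactor (SL2_mx a) j i.
Proof.
by rewrite SL2_mxE /invmx SL2_unit SL2_det invr1 scale1r mxE.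
Qed.

Lemma SL2_inv_continuous : continuous SL2_inv.
Proof.
apply: continuous_SL2 => i j.
under eq_fun do rewrite SL2_inv_adj /cofactor det_mx11 !mxE.
by apply: continuousR_mul; [exact: continuousR_cst|exact: SL2_coord_continuous].
Qed.

Lemma SL2_opp_continuous : continuous SL2_opp.
Proof.
apply: continuous_SL2 => i j.
under eq_fun do rewrite SL2_mxE mxE.
by apply: continuousR_opp; exact: SL2_coord_continuous.
Qed.

Lemma PSL2_class_open (a : SL2) (U : set SL2) :
  nbhs a U -> nbhs (PSL2_class a) (PSL2_class @` U).
Proof.
rewrite nbhsE => -[V [oV Va] VU].
suff nV : nbhs (PSL2_class a) (PSL2_class @` V).
  by apply: filterS nV; exact: image_subset.
rewrite nbhsE; exists (PSL2_class @` V) => //; split; last by exists a.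
have oW : open (V `|` SL2_opp @^-1` V).
  apply: openU => //; move: SL2_opp_continuous => /continuousP; exact.
rewrite /open /= /quotient_open; rewrite (_ : _ @^-1` _ = V `|` SL2_opp @^-1` V) //.
apply/seteqP; split => b /=.
  case=> c Vc /PSL2_classP [E|E]; [left|right].
    by rewrite -(SL2_inj E).
  by rewrite (_ : SL2_opp b = c) //; apply: SL2_inj; rewrite SL2_mxE E.
case=> Vb; first by exists b.
by exists (SL2_opp b) => //; apply/PSL2_classP; right.
Qed.

Lemma PSL2_mul_continuous : continuous (fun p : PSL2 * PSL2 => (p.1 * p.2)%g).
Proof.
move=> [x y]; have [a ->] := PSL2_surj x; have [b ->] := PSL2_surj y => W.
rewrite /= -PSL2_classM => /(PSL2_class_continuous (x := SL2_mul a b)) nW.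
have [[U V] /= [nU nV] UVW] := SL2_mul_continuous (x := (a, b)) nW.
exists (PSL2_class @` U, PSL2_class @` V) => /=.
  by split; exact: PSL2_class_open.
move=> [_ _] /= [[c Uc <-] [d Vd <-]].
by have := UVW (c, d) (conj Uc Vd); rewrite /= PSL2_classM.
Qed.

Lemma PSL2_inv_continuous : continuous (fun x : PSL2 => x^-1%g).
Proof.
move=> x; have [a ->] := PSL2_surj x => W.
rewrite /= -PSL2_classV => /(PSL2_class_continuous (x := SL2_inv a)) nW.
have nU := SL2_inv_continuous (x := a) nW.
apply: filterS (PSL2_class_open nU) => _ [b Wb <-] /=.
by rewrite -PSL2_classV.
Qed.

HB.instance Definition _ :=
  isTopologicalGroup.Build PSL2 PSL2_mul_continuous PSL2_inv_continuous.

End PSL2.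
Arguments SL2 R : clear implicits.
Arguments PSL2 R : clear implicits.

Section MotionGroup.
Context {R : realType}.
Local Notation I := (unitI R).

Lemma rot_subproof (r : R) :
  \det (\matrix_(i < 2, j < 2)
    if i == j then cos (trigo.pi * r) else
    if (i < j)%N then - sin (trigo.pi * r) else sin (trigo.pi * r)) = 1.
Proof.
rewrite (expand_det_row _ 0) !big_ord_recl big_ord0 addr0 /cofactor !det_mx11.
rewrite !mxE /= expr0 mul1r expr1 mulN1r mulrNN -!expr2 cos2Dsin2 //.
Qed.

Definition PSL2_rot (r : R) : PSL2 R := PSL2_class (mkSL2 (rot_subproof r)).

Lemma PSL2_rot_continuous : continuous PSL2_rot.
Proof.
apply: (@continuous_compose _ _ _ (@PSL2_class R)); first exact: PSL2_class_continuous.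
apply: continuous_SL2 => i j.
under eq_fun do rewrite SL2_mxK mxE.
have c : continuous (fun r : R => trigo.pi * r).
  by apply: continuousR_mul => //; [exact: continuousR_cst|move=> y; exact: cvg_id].
have cs : continuous (fun r : R => sin (trigo.pi * r)).
  by apply: (continuous_compose (g := sin)) => // y; exact: continuous_sin.
case: eqP => _.
  by apply: (continuous_compose (g := cos)) => // y; exact: continuous_cos.
by case: ltnP => _ //; exact: continuousR_opp.
Qed.

Lemma PSL2_rotD r s : PSL2_rot (r + s) = (PSL2_rot r * PSL2_rot s)%g.
Proof.
rewrite -PSL2_classM; apply/PSL2_classP; left; apply/matrixP => i j.
rewrite SL2_mxM !SL2_mxK !mxE !big_ord_recl big_ord0 addr0 !mxE mulrDr cosD sinD.
case: i => -[|[|//]] ?; case: j => -[|[|//]] ?; rewrite /=; ring.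
Qed.

Lemma PSL2_rot0 : PSL2_rot 0 = 1%g.
Proof.
apply: (@mulgI _ (PSL2_rot 0)).
by rewrite -PSL2_rotD addr0 mulg1.
Qed.

Lemma PSL2_rot_nat (n : nat) : PSL2_rot n%:R = 1%g.
Proof.
elim: n => [|n IH]; first exact: PSL2_rot0.
rewrite -natr1 PSL2_rotD IH mul1g; apply/PSL2_classP; right; apply/matrixP => i j.
rewrite SL2_mx1 SL2_mxK !mxE mulr1 cospi sinpi oppr0.
by case: i => -[|[|//]] ?; case: j => -[|[|//]] ?; rewrite //= ?oppr0.
Qed.

Lemma PSL2_rot_int (n : int) : PSL2_rot n%:~R = 1%g.
Proof.
case: n => n; first exact: PSL2_rot_nat.
apply: (@mulgI _ (PSL2_rot (n.+1)%:R)).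
by rewrite -PSL2_rotD NegzE mulrNz subrr PSL2_rot0 PSL2_rot_nat mulg1.
Qed.

Definition SLtilde : Type := universal_cover (R := R) (PSL2 R).
HB.instance Definition _ := Group.on SLtilde.

Lemma rot_path_continuous (r : R) :
  continuous (fun t : I => PSL2_rot (r * ival t)).
Proof.
apply: (continuous_compose (g := PSL2_rot)); first exact: PSL2_rot_continuous.
by apply: continuousR_mul; [exact: continuousR_cst|exact: ival_continuous].
Qed.

Lemma rot_path0 (r : R) : PSL2_rot (r * ival (zero : I)) = 1%g.
Proof. by rewrite ival0 mulr0 PSL2_rot0. Qed.

Definition rot_path (r : R) : based_path (R := R) (PSL2 R) :=
  BasedPath (@rot_path_continuous r) (rot_path0 r).

(* The path t |-> k (r t) represents the value at r of the lift of k to the   *)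
(* universal cover.                                                           *)
Definition SLtilde_rot (r : R) : SLtilde := cover_class (rot_path r).

Lemma SLtilde_rotD r s :
  SLtilde_rot (r + s) = (SLtilde_rot r * SLtilde_rot s)%g.
Proof.
rewrite -qclassM; apply/qclassP; apply: bpath_ext => t /=.
by rewrite -PSL2_rotD mulrDl.
Qed.

Lemma SLtilde_rot0 : SLtilde_rot 0 = 1%g.
Proof.
by apply: (@mulgI _ (SLtilde_rot 0)); rewrite -SLtilde_rotD addr0 mulg1.
Qed.

Lemma SLtilde_rot_central (n : int) (x : SLtilde) :
  (SLtilde_rot n%:~R * x = x * SLtilde_rot n%:~R)%g.
Proof.
by apply: cover_loop_central; rewrite /= ival1 mulr1 PSL2_rot_int.
Qed.

Local Notation P := (SLtilde * R)%type.

(* equality modulo the central subgroup of the (SLtilde_rot n, - n)           *)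
Definition motion_eqv (p q : P) := exists n : int,
  q = ((p.1 * SLtilde_rot n%:~R)%g, p.2 - n%:~R).

Program Definition motion_setoidGroup : setoidGroup P := {|
  sg_eqv := motion_eqv;
  sg_mul := fun p q => ((p.1 * q.1)%g, p.2 + q.2);
  sg_one := (1%g, 0);
  sg_inv := fun p => (p.1^-1%g, - p.2) |}.
Next Obligation.
by move=> p; exists 0; rewrite subr0 SLtilde_rot0 mulg1; case: p.
Qed.
Next Obligation.
move=> p _ [n ->]; exists (- n) => /=.
rewrite -mulgA -SLtilde_rotD mulrNz subrr SLtilde_rot0 mulg1 opprK subrK.
by case: p.
Qed.
Next Obligation.
move=> p _ _ [n ->] [m ->]; exists (n + m) => /=.
by rewrite -mulgA -SLtilde_rotD !intrD opprD addrA.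
Qed.
Next Obligation.
move=> p _ q _ [n ->] [m ->]; exists (n + m) => /=; congr pair.
  rewrite intrD SLtilde_rotD -!mulgA; congr (_ * _)%g.
  by rewrite !mulgA SLtilde_rot_central.
by rewrite intrD; ring.
Qed.
Next Obligation.
move=> p _ [n ->]; exists (- n) => /=; congr pair; last by rewrite mulrNz; ring.
rewrite -SLtilde_rot_central invgM; congr (_ * _)%g.
apply: (@mulgI _ (SLtilde_rot n%:~R)).
by rewrite mulgV -SLtilde_rotD mulrNz subrr SLtilde_rot0.
Qed.
Next Obligation.
by move=> p q r; exists 0; rewrite subr0 SLtilde_rot0 mulg1 /= mulgA addrA.
Qed.
Next Obligation.
by move=> p; exists 0; rewrite subr0 SLtilde_rot0 mulg1 /= mul1g add0r; case: p.
Qed.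
Next Obligation.
by move=> p; exists 0; rewrite subr0 SLtilde_rot0 mulg1 /= mulg1 addr0; case: p.
Qed.
Next Obligation.
by move=> p; exists 0; rewrite subr0 SLtilde_rot0 mulg1 /= mulVg addNr.
Qed.
Next Obligation.
by move=> p; exists 0; rewrite subr0 SLtilde_rot0 mulg1 /= mulgV subrr.
Qed.

Definition motion_group : Type := quotient_group motion_setoidGroup.
HB.instance Definition _ := Group.on motion_group.

End MotionGroup.
Arguments SLtilde R : clear implicits.
Arguments motion_group R : clear implicits.

Definition is_homeomorphism {X Y : topologicalType} (f : X -> Y) : Prop :=
  exists g : Y -> X, [/\ continuous f, continuous g, cancel f g & cancel g f].

Definition is_embedding {X Y : topologicalType} (f : X -> Y) : Prop :=
  [/\ continuous f, injective f &
      forall U, open U -> exists2 V, open V & U = f @^-1` V].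

Section ModelSpaces.
Variable R : realType.

Definition circle : Type := set_type [set p : R * R | p.1 ^+ 2 + p.2 ^+ 2 = 1].
HB.instance Definition _ := Topological.on circle.

Definition disk : Type := set_type [set p : R * R | p.1 ^+ 2 + p.2 ^+ 2 <= 1].
HB.instance Definition _ := Topological.on disk.

Definition torus : Type := (circle * circle)%type.
HB.instance Definition _ := Topological.on torus.

Definition sphere : Type :=
  set_type [set p : 'rV[R]_3 | \sum_i p 0 i ^+ 2 = 1].
HB.instance Definition _ := Topological.on sphere.

Definition ball3 : Type :=
  set_type [set p : 'rV[R]_3 | \sum_i p 0 i ^+ 2 <= 1].
HB.instance Definition _ := Topological.on ball3.

Definition symI : Type := set_type (`[-1, 1]%classic : set R).
HB.instance Definition _ := Topological.on symI.

Definition slice {Y X : topologicalType} (e : Y * symI -> X) (s : R) : set X :=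
  e @` [set q | set_val q.2 = s].

Definition open_collar {Y X : topologicalType} (e : Y * symI -> X) : set X :=
  e @` [set q | -1 < set_val q.2 < 1].

(* The compact orientable surface of genus g with b boundary circles, in R^3. *)
(* The locus where the polynomial surface_poly is nonnegative is a round disk *)
(* of radius 3 (g + b + 1) minus g open unit disks with centres on the        *)
(* positive x-axis; z ^ 2 = surface_poly x y is the idouble of this planar     *)
(* region, i.e. the closed surface of genus g. From its upper sheet one       *)
(* removes b open unit disks with centres on the negative x-axis.             *)
Definition surface_poly (g b : nat) (x y : R) : R :=
  ((3 * (g + b).+1)%:R ^+ 2 - x ^+ 2 - y ^+ 2) *
  \prod_(i < g) ((x - (3 * i.+1)%:R) ^+ 2 + y ^+ 2 - 1).

Definition hole_dist2 (j : nat) (p : R * R * R) : R :=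
  (p.1.1 + (3 * j.+1)%:R) ^+ 2 + p.1.2 ^+ 2.

Definition surface (g b : nat) : Type := set_type [set p : R * R * R |
  p.2 ^+ 2 = surface_poly g b p.1.1 p.1.2 /\
  forall j : 'I_b, 0 < p.2 -> 1 <= hole_dist2 j p].
HB.instance Definition _ g b := Topological.on (surface g b).

Definition surface_boundary (g b : nat) (j : 'I_b) : set (surface g b) :=
  [set s | 0 < (set_val s).2 /\ hole_dist2 j (set_val s) = 1].

Definition rotate (t : R) (p : R * R) : R * R :=
  (cos t * p.1 - sin t * p.2, sin t * p.1 + cos t * p.2).

(* the fibre through a of the standard fibred solid torus of type (p, q) *)
Definition model_fibre (p : nat) (q : int) (a : disk * circle) :
    set (disk * circle) :=
  [set c | exists t : R, set_val c.1 = rotate (q%:~R * t) (set_val a.1) /\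
                         set_val c.2 = rotate (p%:R * t) (set_val a.2)].

End ModelSpaces.

Section ThreeManifolds.
Variables (R : realType) (X : topologicalType).

Definition manifold_interior : set X := [set x | exists U : set X,
  exists W : set 'rV[R]_3, [/\ open U, U x, open W &
    exists f : U -> W, is_homeomorphism f]].

Definition manifold_boundary : set X := ~` manifold_interior.

Definition boundary_component (C : set X) : Prop :=
  exists2 x, manifold_boundary x & C = connected_component manifold_boundary x.

Record chart := Chart {
  chart_dom : set X;
  chart_cod : set 'rV[R]_3;
  chart_map : X -> 'rV[R]_3;
  chart_inv : 'rV[R]_3 -> X;
  chart_dom_open : open chart_dom;
  chart_cod_open : exists2 W : set 'rV[R]_3, open W &
    chart_cod = W `&` [set p : 'rV[R]_3 | 0 <= p 0 0];
  chart_map_continuous : {within chart_dom, continuous chart_map};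
  chart_inv_continuous : {within chart_cod, continuous chart_inv};
  chart_map_cod : forall x, chart_dom x -> chart_cod (chart_map x);
  chart_inv_dom : forall p, chart_cod p -> chart_dom (chart_inv p);
  chart_mapK : forall x, chart_dom x -> chart_inv (chart_map x) = x;
  chart_invK : forall p, chart_cod p -> chart_map (chart_inv p) = p }.

(* An orientation is an atlas whose transition maps have positive Jacobian at *)
(* interior points; only compact manifolds occur, so second countability is   *)
(* automatic.                                                                 *)
Definition oriented_3manifold : Prop :=
  hausdorff_space X /\ exists A : set chart,
    (forall x, exists2 c, A c & chart_dom c x) /\
    forall c d p, A c -> A d -> chart_cod c p -> 0 < p 0 0 ->
      chart_dom d (chart_inv c p) ->
      differentiable (chart_map d \o chart_inv c) p /\
      0 < \det ('J (chart_map d \o chart_inv c) p).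

(* e runs over the bicollared spheres, which excludes wild ones *)
Definition irreducible_3manifold : Prop :=
  forall e : sphere R * symI R -> X, is_embedding e ->
  exists b : ball3 R -> X, is_embedding b /\
    b @` [set p : ball3 R | \sum_i (set_val p : 'rV[R]_3) 0 i ^+ 2 = 1] = slice e 0.

(* pi1-injectivity of a two-sided surface *)
Definition incompressible (S : set X) : Prop :=
  forall x : S, injective (@pi1_map R S X (@set_incl X S) x).

(* fib x is the fibre through x. A fibre in the boundary has a neighbourhood  *)
(* of type (1, 0) in whose boundary it lies.                                  *)
Definition seifert_fibered : Prop := exists fib : X -> set X, forall x,
  fib x x /\ exists (p : nat) (q : int) (h : disk R * circle R -> X),
  [/\ (0 < p)%N, coprime p `|q|%N, is_embedding h,
      forall y, fib x y -> nbhs y (range h) &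
      forall a, fib (h a) = h @` model_fibre p q a].

Definition atoroidal : Prop := forall e : torus R * symI R -> X,
  is_embedding e -> incompressible (slice e 0) ->
  exists k : torus R * unitI R -> X, [/\ is_embedding k,
    k @` [set q | ival q.2 = 0] = slice e 0 &
    boundary_component (k @` [set q | ival q.2 = 1])].

End ThreeManifolds.

(* The JSJ tori are given with disjoint product neighbourhoods. Removing the  *)
(* open neighbourhoods of some of the tori leaves a compact manifold whose    *)
(* components are the pieces obtained by cutting along these tori. A JSJ      *)
(* family is a minimal family of incompressible tori whose pieces are Seifert *)
(* fibred or atoroidal. JSJ_open follows from the other fields by invariance  *)
(* of domain.                                                                 *)
Section JSJ.
Variables (R : realType) (M : topologicalType) (E : finType).
Variable collar : E -> torus R * symI R -> M.

Definition cut_along (K : {set E}) : set M :=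
  ~` \bigcup_(i in [set i | i \in K]) open_collar (collar i).

Definition pieces (K : {set E}) : set (set M) :=
  [set N | exists2 x, cut_along K x & N = connected_component (cut_along K) x].

Definition seifert_or_atoroidal (K : {set E}) : Prop :=
  forall N : set M, pieces K N -> seifert_fibered R N \/ atoroidal R N.

Record is_JSJ : Prop := {
  JSJ_embedding : forall i, is_embedding (collar i);
  JSJ_open : forall i, open (open_collar (collar i));
  JSJ_interior : forall i, range (collar i) `<=` manifold_interior R (X := M);
  JSJ_disjoint : forall i j, i != j ->
    range (collar i) `&` range (collar j) = set0;
  JSJ_incompressible : forall i, incompressible R (slice (collar i) 0);
  JSJ_pieces : seifert_or_atoroidal [set: E]%SET;
  JSJ_minimal : forall K : {set E}, K != [set: E]%SET -> ~ seifert_or_atoroidal K }.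

End JSJ.

(* gm_block enumerates the JSJ pieces. gm_bundle_boundary says that gm_bundle *)
(* maps the boundary of the bundle onto the boundary of the block, which      *)
(* consists of points of the boundary of M and of the ends of the collars;    *)
(* this also follows from invariance of domain.                               *)
Record graph_manifold (R : realType) (M : topologicalType) := GraphManifold {
  gm_vertex : finType;
  gm_edge : finType;
  gm_block : gm_vertex -> set M;
  gm_collar : gm_edge -> torus R * symI R -> M;
  gm_genus : gm_vertex -> nat;
  gm_holes : gm_vertex -> nat;
  gm_bundle : forall v,
    surface R (gm_genus v) (gm_holes v) * circle R -> gm_block v;
  gm_compact : compact [set: M];
  gm_connected : connected [set: M];
  gm_oriented : oriented_3manifold R M;
  gm_irreducible : irreducible_3manifold R M;
  gm_boundary_tori : forall C : set M, boundary_component R C ->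
    exists f : torus R -> C, is_homeomorphism f;
  gm_JSJ : is_JSJ gm_collar;
  gm_block_inj : injective gm_block;
  gm_blocks : range gm_block = pieces gm_collar [set: gm_edge]%SET;
  gm_seifert : forall v, seifert_fibered R (gm_block v);
  gm_genus_gt1 : forall v, (1 < gm_genus v)%N;
  gm_bundleP : forall v, is_homeomorphism (@gm_bundle v);
  gm_bundle_boundary : forall v,
    [set set_incl (gm_bundle q) | q in
       [set q : surface R (gm_genus v) (gm_holes v) * circle R |
         exists j, surface_boundary j q.1]] =
    gm_block v `&` (manifold_boundary R (X := M) `|`
      \bigcup_i (slice (gm_collar i) (-1) `|` slice (gm_collar i) 1)) }.

Section DualGraph.
Variables (R : realType) (M : topologicalType) (D : graph_manifold R M).

Definition gm_joins (i : gm_edge D) (v w : gm_vertex D) : Prop :=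
  (slice (gm_collar i) (-1) `<=` gm_block v /\ slice (gm_collar i) 1 `<=` gm_block w) \/
  (slice (gm_collar i) (-1) `<=` gm_block w /\ slice (gm_collar i) 1 `<=` gm_block v).

Definition dual_graph : rel (gm_vertex D) :=
  fun v w => `[< exists i, gm_joins i v w >].

Definition dual_graph_simple : Prop :=
  (forall v, ~~ dual_graph v v) /\
  (forall i j v w, gm_joins i v w -> gm_joins j v w -> i = j).

Definition boundary_torus (v : gm_vertex D) (j : 'I_(gm_holes v)) : set M :=
  [set set_incl (gm_bundle q) | q in
     [set q : surface R (gm_genus v) (gm_holes v) * circle R |
       surface_boundary j q.1]].
End DualGraph.
Arguments dual_graph {R M} D.
Arguments dual_graph_simple {R M} D.

Definition is_tree (V : finType) (e : rel V) : Prop :=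
  (forall v w, connect e v w) /\ (forall c, ucycle e c -> (size c <= 2)%N).

Definition valence (V : finType) (e : rel V) (v : V) : nat := #|[set w | e v w]%SET|.

(* Main.v *)
Require Import Defs.
From HB Require Import structures.
From mathcomp Require Import all_boot all_order all_algebra.
From mathcomp Require Import all_classical all_reals all_analysis.
From mathcomp Require Import generic_quotient homotopy ring lra zify.
Set Implicit Arguments.
Unset Strict Implicit.
Unset Printing Implicit Defensive.
Import Order.TTheory GRing.Theory Num.Theory.
Import numFieldNormedType.Exports numFieldTopology.Exports.
Local Open Scope classical_set_scope.
Local Open Scope ring_scope.

(* M retracts onto every block B_v. Let F be a compact orientable surface
with at least two boundary circles. The class dual to an arc joining two
of them is a map from F to the circle that restricts to a homeomorphism on the
first, so F x S^1 retracts onto the first boundary torus. Root the tree at v.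
Every other block has a second boundary torus: another JSJ torus if its valence
is at least two, a torus in the boundary of M if it is an end. Hence it can be
collapsed onto the torus facing the root and pushed through the collar into the
preceding block. Composing these retractions gives r : M -> B_v, and rho0
composed with the map induced by r on pi1 extends rho0. *)

(** * Topology *)

(** The union of the other members is closed, the index type being finite, and disjoint from [F i0];
    a connected set cannot meet both. This will match the ends of collars with boundary tori of
    blocks. *)
Lemma connected_sub_disjoint_closed (T : topologicalType) (I : finType)
    (F : I -> set T) (S : set T) (i0 : I) :
  (forall i, closed (F i)) -> (forall i j, i != j -> F i `&` F j = set0) ->
  connected S -> S `<=` \bigcup_i F i -> S `&` F i0 !=set0 -> S `<=` F i0.
Proof.
move=> cF dF cS SF [x [Sx Fx]].
pose Z := \bigcup_(i in [set i | i != i0]) F i.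
have cZ : closed Z by apply: closed_bigcup => //; exact: finite_finset.
have sep : separated (F i0) Z.
  rewrite /separated -(closure_id (F i0)).1 // -(closure_id Z).1 //.
  suff -> : F i0 `&` Z = set0 by [].
  rewrite -subset0 => y [Fy [i /= ii0 Fiy]].
  by have : (F i `&` F i0) y by []; rewrite dF.
have SFZ : S `<=` F i0 `|` Z.
  move=> y /SF [i _ Fy]; have [<-|ii0] := eqVneq i i0; first by left.
  by right; exists i.
case: (connected_subset sep SFZ cS) => // SZ.
by have [i /= ii0 Fix] := SZ _ Sx; move: (dF _ _ ii0); rewrite -subset0 => /(_ x); case.
Qed.

Lemma within_comp (X Y Z : topologicalType) (A : set X) (B : set Y)
    (f : X -> Y) (g : Y -> Z) :
  {within A, continuous f} -> {within B, continuous g} -> f @` A `<=` B ->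
  {within A, continuous (g \o f)}.
Proof.
move=> /subspace_continuousP cf /subspace_continuousP cg AB.
apply/subspace_continuousP => x Ax; have Bfx : B (f x) by apply: AB; exists x.
apply: cvg_comp (cg _ Bfx) => U nU.
have n1 : nbhs x [set y | A y -> B (f y) -> U (f y)] := cf x Ax _ nU.
suff : nbhs x [set y | A y -> U (f y)] by [].
by apply: filterS n1 => y H Ay; apply: H => //; apply: AB; exists y.
Qed.

Lemma connected_prod (X Y : topologicalType) :
  connected [set: X] -> connected [set: Y] -> connected [set: X * Y].
Proof.
move=> cX cY; have [[[x0 y0] _]|n] := pselect ([set: X * Y] !=set0); last first.
  rewrite (_ : setT = set0); first exact: connected0.
  by apply/seteqP; split => // p _; apply: n; exists p.
have cx (x : X) : connected (pair x @` [set: Y]).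
  apply: connected_continuous_connected => //; apply: continuous_subspaceT.
  by apply: continuous_pair => // y; [exact: cst_continuous|exact: cvg_id].
have cy (y : Y) : connected ((fun x => (x, y)) @` [set: X]).
  apply: connected_continuous_connected => //; apply: continuous_subspaceT.
  by apply: continuous_pair => // x; [exact: cvg_id|exact: cst_continuous].
(* The product is a union of connected crosses that all contain the point [(x0, y0)]. *)
rewrite (_ : setT = \bigcup_y (pair x0 @` [set: Y] `|` (fun x => (x, y)) @` [set: X])).
  apply: bigcup_connected.
    by exists (x0, y0) => y _; left; exists y0.
  move=> y _; apply: connectedU => //.
  by exists (x0, y); split; [exists y|exists x0].
by apply/seteqP; split => // -[x y] _; exists y => //; right; exists x.
Qed.

Lemma sqr_sum1_bound (R : realType) (x y : R) : x ^+ 2 + y ^+ 2 = 1 -> -1 <= x <= 1.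
Proof.
move=> xy1; have yy := sqr_ge0 y; rewrite !expr2 in xy1 yy.
apply/andP; split; rewrite leNgt; apply/negP => x1; nra.
Qed.

(** * The circle and the torus *)

Section ModelSpaces.
Variable R : realType.

Definition mk_circle (p : R * R) (p1 : p.1 ^+ 2 + p.2 ^+ 2 = 1) : circle R :=
  exist (fun q => q \in [set q : R * R | q.1 ^+ 2 + q.2 ^+ 2 = 1]) p (mem_set p1).

Definition circle_angle (t : R) : circle R :=
  @mk_circle (cos t, sin t) (cos2Dsin2 t).

Lemma circle_angle_continuous : continuous circle_angle.
Proof.
apply: continuous_set_type; apply: continuous_pair => t; first exact: continuous_cos.
exact: continuous_sin.
Qed.

Lemma circle_angle_surj : circle_angle @` `[- trigo.pi, trigo.pi] = setT.
Proof.
apply/seteqP; split => // c _.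
have c1 : (set_val c).1 ^+ 2 + (set_val c).2 ^+ 2 = 1 := set_valP c.
case E : (set_val c) c1 => [x y] /= xy1.
have x1 := sqr_sum1_bound xy1.
have y2 : Num.sqrt (1 - x ^+ 2) = `|y| by rewrite -xy1 addrAC subrr add0r sqrtr_sqr.
have [a0 api] : 0 <= acos x /\ acos x <= trigo.pi.
  by split; [exact: acos_ge0|exact: acos_lepi].
have pi0 := trigo.pi_ge0 R.
have [y0|y0] := leP 0 y.
  exists (acos x); first by rewrite /= in_itv /=; clear -a0 api pi0; apply/andP; split; lra.
  by apply: val_inj; rewrite -[RHS]/(set_val c) E /= sin_acos // acosK // y2 ger0_norm //.
exists (- acos x); first by rewrite /= in_itv /=; clear -a0 api pi0; apply/andP; split; lra.
apply: val_inj; rewrite -[RHS]/(set_val c) E /= cosN sinN sin_acos // acosK //.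
by rewrite y2 ltr0_norm // opprK.
Qed.

Lemma circle_connected : connected [set: circle R].
Proof.
rewrite -circle_angle_surj; apply: connected_continuous_connected.
  exact: segment_connected.
by apply: continuous_subspaceT; exact: circle_angle_continuous.
Qed.

Lemma circle_compact : compact [set: circle R].
Proof.
rewrite -circle_angle_surj; apply: continuous_compact; last exact: segment_compact.
by apply: continuous_subspaceT; exact: circle_angle_continuous.
Qed.

Lemma torus_compact : compact [set: torus R].
Proof. by rewrite -setXTT; apply: compact_setX; exact: circle_compact. Qed.

Lemma torus_connected : connected [set: torus R].
Proof. by apply: connected_prod; exact: circle_connected. Qed.

(** The boolean names a side of a collar; the definition is transparent so that the underlying real
    number computes. *)
Definition sym_end (b : bool) : symI R.
Proof.
exists (if b then 1 else -1); rewrite inE /= in_itv /=.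
by case: b; apply/andP; split; lra.
Defined.

Lemma symI_compact : compact [set: symI R].
Proof.
(* Clamping the line to the segment exhibits [symI R] as a continuous image of a compact
   interval. *)
have cl (x : R) : Num.max (-1) (Num.min x 1) \in (`[-1, 1]%classic : set R).
  by rewrite inE /= in_itv /= le_max lexx /= ge_max ge_min lexx orbT andbT; lra.
pose f (x : R) : symI R := exist (fun y : R => y \in (`[-1, 1]%classic : set R)) _ (cl x).
have cf : continuous f.
  apply: continuous_set_type => x.
  have -> : set_val \o f = fun x => Num.max (-1) (Num.min x 1) by [].
  apply: continuousR_max; first exact: cst_continuous.
  by apply: continuousR_min; [move=> y; exact: cvg_id|exact: cst_continuous].
rewrite (_ : setT = f @` `[-1, 1]).
  apply: continuous_compact; last exact: segment_compact.
  exact: continuous_subspaceT.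
apply/seteqP; split => // s _; exists (set_val s); first exact: set_valP.
apply: val_inj => /=; have : `[-1, 1]%classic (set_val s) by exact: set_valP.
by rewrite /= in_itv /= => /andP[s0 s1]; rewrite (min_idPl s1) (max_idPr s0).
Qed.

End ModelSpaces.

(** * Retracting a surface onto a boundary circle *)

Section SurfaceRetraction.
Variable R : realType.
Implicit Types n m x y : R.

(* First coordinate of a map to the plane with second coordinate y: on the axis
y = 0 it is negative exactly between the hole centres - n and - m, and it is
positive where the two sheets of the surface meet. So the negative real half
line pulls back to the segment joining the two holes. *)
Definition segment_gauge n m x y : R :=
  `|x + (n + m) / 2| - `|n - m| / 2 + `|n - m| * Num.max 0 (`|y| - 1).

Lemma segment_gauge_eq0 n m x : segment_gauge n m x 0 = 0 -> x = - n \/ x = - m.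
Proof.
rewrite /segment_gauge normr0 sub0r (max_idPl _) ?oppr_le0 // mulr0 addr0.
have [h1|h1] := ler0P (x + (n + m) / 2); have [h2|h2] := ler0P (n - m) => h.
- by right; lra.
- by left; lra.
- by left; lra.
- by right; lra.
Qed.

(** Here [|y| <= 1] kills the last term, and centres at least 3 apart fix the sign inside the first
    absolute value. So, up to the sign of the first coordinate, the pair of gauge and [y] merely
    translates the rim of the hole to the origin. *)
Lemma segment_gauge_circle n m x y : (3 <= `|n - m|) -> (x + n) ^+ 2 + y ^+ 2 = 1 ->
  segment_gauge n m x y = if n < m then x + n else - (x + n).
Proof.
move=> nm /[dup] /sqr_sum1_bound /andP[x0 x1]; rewrite addrC => /sqr_sum1_bound y1.
rewrite /segment_gauge (max_idPl _) ?mulr0 ?addr0; last first.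
  by rewrite subr_le0 ler_norml.
case: ltP nm => nm.
  by rewrite ltr0_norm ?subr_lt0 // => nm3; rewrite ger0_norm; lra.
by rewrite ger0_norm ?subr_ge0 // => nm3; rewrite ler0_norm; lra.
Qed.

Lemma segment_gauge_gt0_right n m x y : 0 < n -> 0 < m -> 0 < x ->
  0 < segment_gauge n m x y.
Proof.
move=> n0 m0 x0; rewrite /segment_gauge.
have h0 : 0 <= `|n - m| * Num.max 0 (`|y| - 1).
  by rewrite mulr_ge0 // le_max lexx.
have h1 : `|x + (n + m) / 2| = x + (n + m) / 2 by rewrite gtr0_norm //; lra.
have h2 : `|n - m| < n + m by rewrite ltr_norml; apply/andP; split; lra.
rewrite h1; lra.
Qed.

(** Used for the outer circle of the planar region. Where [|y|] is at least 2, the last term of the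
    gauge alone outweighs the negative one; elsewhere [|x|] exceeds [r - 2], which puts [x] beyond
    both hole centres. *)
Lemma segment_gauge_gt0_far n m x y r : 0 < n -> 0 < m -> 3 <= `|n - m| ->
  n + 3 <= r -> m + 3 <= r -> x ^+ 2 + y ^+ 2 = r ^+ 2 -> 0 < segment_gauge n m x y.
Proof.
move=> n0 m0 nm nr mr xyr; rewrite /segment_gauge.
set D := `|n - m| in nm *.
have [y2|y2] := leP 2 `|y|.
  have h1 : 1 <= Num.max 0 (`|y| - 1) by rewrite le_max; apply/orP; right; lra.
  have h2 := normr_ge0 (x + (n + m) / 2).
  have h3 : D <= D * Num.max 0 (`|y| - 1) by rewrite ler_peMr //; lra.
  lra.
have h0 : 0 <= D * Num.max 0 (`|y| - 1).
  by rewrite mulr_ge0 ?le_max ?lexx //; lra.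
have y4 : y ^+ 2 < 4.
  rewrite -[y ^+ 2]real_normK ?num_real //.
  by have := normr_ge0 y; rewrite expr2 => ?; nra.
have xr : r - 2 < `|x|.
  rewrite ltNge; apply/negP => xr.
  have : x ^+ 2 <= (r - 2) ^+ 2.
    by rewrite -[x ^+ 2]real_normK ?num_real // ler_pXn2r // nnegrE; lra.
  rewrite !expr2 in xyr y4 *; nra.
suff : D / 2 < `|x + (n + m) / 2| by lra.
rewrite /D; case: (ger0P x) xr => x0 xr.
  rewrite (ger0_norm (x := x + _)); last lra.
  by have [] := ger0P (n - m); lra.
rewrite (ler0_norm (x := x + _)); last lra.
by have [] := ger0P (n - m); lra.
Qed.

Variables g b : nat.

(** Hole [j] is centred at [- hole_pos j] on the x-axis; the same numbers taken positive are the
    centres of the disks that create the genus. *)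
Definition hole_pos (j : nat) : R := (3 * j.+1)%:R.

Lemma hole_pos_ge3 j : 3 <= hole_pos j.
Proof. by rewrite ler_nat leq_pmulr. Qed.

Lemma hole_pos_dist i j : i != j -> 3 <= `|hole_pos i - hole_pos j|.
Proof.
wlog ij : i j / (i < j)%N => [H|_].
  rewrite neq_ltn => /orP[ij|ji]; first by apply: H => //; rewrite ltn_eqF.
  by rewrite distrC; apply: H => //; rewrite ltn_eqF.
rewrite distrC /hole_pos -natrB ?ger0_norm ?ler_nat //; lia.
Qed.

Lemma hole_pos_radius (j : 'I_b) : hole_pos j + 3 <= (3 * (g + b).+1)%:R.
Proof. rewrite -natrD ler_nat; have := ltn_ord j; lia. Qed.

(** The rim of a hole lies strictly inside the planar region, so a positive square root lifts it to
    the upper sheet. *)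
Lemma surface_poly_gt0 (j : 'I_b) x y :
  (x + hole_pos j) ^+ 2 + y ^+ 2 = 1 -> 0 < surface_poly g b x y.
Proof.
move=> xy1; have /andP[x0 x1] := sqr_sum1_bound xy1.
have n3 := hole_pos_ge3 j; have nr := hole_pos_radius j.
move: (hole_pos j) n3 nr xy1 x0 x1 => n n3 nr xy1 x0 x1.
rewrite /surface_poly mulr_gt0 //.
  move: ((3 * (g + b).+1)%:R) nr => r nr; rewrite !expr2 in xy1 *.
  have h1 : 0 <= n * (x + n + 1) by rewrite mulr_ge0 //; lra.
  have h2 : 0 <= (r - (n + 3)) * (r + (n + 3)) by rewrite mulr_ge0 //; lra.
  lra.
apply: prodr_gt0 => i _; have k3 := hole_pos_ge3 i.
rewrite -/(hole_pos i); move: (hole_pos i) k3 => k k3; rewrite !expr2 in xy1 *.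
(* By the equation of the rim this product equals the factor of [surface_poly] at hand. *)
have : 0 < (n + k) * (k - n - 2 * x) by rewrite mulr_gt0 //; lra.
lra.
Qed.

Lemma hole_dist2_ge1 (i j : nat) x y z :
  (x + hole_pos j) ^+ 2 + y ^+ 2 = 1 -> 1 <= hole_dist2 i (x, y, z).
Proof.
move=> xy1; rewrite /hole_dist2 /= -/(hole_pos i).
have [->|ij] := eqVneq i j; first by rewrite xy1.
have /andP[x0 x1] := sqr_sum1_bound xy1; have := hole_pos_dist ij.
move: (hole_pos i) (hole_pos j) xy1 x0 x1 => m n xy1 x0 x1.
by rewrite ler_normr => /orP[] h; rewrite !expr2 in xy1 *; nra.
Qed.

(** The sheets meet over the outer circle and over the circles bounding the genus disks; the latter
    lie in the half plane where [x] is positive. *)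
Lemma surface_gauge_gt0 (i j : 'I_b) x y : i != j -> surface_poly g b x y = 0 ->
  0 < segment_gauge (hole_pos i) (hole_pos j) x y.
Proof.
move=> ij /eqP; rewrite mulf_eq0 => /orP[|].
  rewrite subr_eq0 subr_eq => /eqP h.
  apply: (segment_gauge_gt0_far (r := (3 * (g + b).+1)%:R)).
  - exact: lt_le_trans (hole_pos_ge3 _).
  - exact: lt_le_trans (hole_pos_ge3 _).
  - exact: hole_pos_dist.
  - exact: hole_pos_radius.
  - exact: hole_pos_radius.
  - by rewrite h addrC.
case/prodf_eq0 => k _; rewrite subr_eq0 => /eqP /sqr_sum1_bound /andP[x1 _].
have k3 := hole_pos_ge3 k; apply: segment_gauge_gt0_right.
- exact: lt_le_trans (hole_pos_ge3 _).
- exact: lt_le_trans (hole_pos_ge3 _).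
- by move: x1 k3; rewrite /hole_pos; lra.
Qed.

(** Radial projection of the punctured plane onto the unit circle, which fixes that circle
    pointwise. *)
Lemma continuous_normalize (Z : topologicalType) (u v : Z -> R) :
  continuous u -> continuous v -> (forall z, ~ (u z = 0 /\ v z = 0)) ->
  exists2 phi : Z -> circle R, continuous phi &
    forall z, u z ^+ 2 + v z ^+ 2 = 1 -> set_val (phi z) = (u z, v z).
Proof.
move=> cu cv uv0; pose r z := Num.sqrt (u z ^+ 2 + v z ^+ 2).
have uv_gt0 z : 0 < u z ^+ 2 + v z ^+ 2.
  rewrite lt_neqAle addr_ge0 ?sqr_ge0 // andbT eq_sym paddr_eq0 ?sqr_ge0 //.
  by rewrite !sqrf_eq0; apply/negP => /andP[/eqP ? /eqP ?]; apply: (uv0 z).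
have r_gt0 z : 0 < r z by rewrite sqrtr_gt0.
have p1 z : (u z / r z) ^+ 2 + (v z / r z) ^+ 2 = 1.
  by rewrite !expr_div_n sqr_sqrtr ?ltW // -mulrDl divff // gt_eqF.
exists (fun z => @mk_circle R (u z / r z, v z / r z) (p1 z)); last first.
  move=> z uv1; rewrite /mk_circle /set_val /=.
  by rewrite /r uv1 sqrtr1 !divr1.
have cr : continuous r.
  apply: (continuous_compose (g := @Num.sqrt R)); first exact: sqrt_continuous.
  by apply: continuousR_add; apply: continuousR_mul.
have cV : continuous (fun z => (r z)^-1).
  by move=> z; apply: cvgV; [rewrite gt_eqF|exact: cr].
by apply: continuous_set_type; apply: continuous_pair; apply: continuousR_mul.
Qed.

Lemma continuousR_norm (Z : topologicalType) (f : Z -> R) :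
  continuous f -> continuous (fun z => `|f z|).
Proof. by move=> cf z; apply: cvg_norm; exact: cf. Qed.

Lemma continuousR_prod (Z : topologicalType) (I : finType) (F : I -> Z -> R) :
  (forall i, continuous (F i)) -> continuous (fun z => \prod_i F i z).
Proof.
move=> cF; elim: (index_enum I) => [|i s IH].
  by under eq_fun do rewrite big_nil; exact: continuousR_cst.
by under eq_fun do rewrite big_cons; exact: continuousR_mul.
Qed.

Lemma segment_gauge_continuous (Z : topologicalType) n m (f h : Z -> R) :
  continuous f -> continuous h -> continuous (fun z => segment_gauge n m (f z) (h z)).
Proof.
move=> cf ch; have cc (k : R) := @continuousR_cst R Z k.
apply: continuousR_add; last first.
  apply: continuousR_mul => //; apply: continuousR_max => //.
  by apply: continuousR_sub => //; exact: continuousR_norm.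
by apply: continuousR_sub => //; apply: continuousR_norm; exact: continuousR_add.
Qed.

Let sx (s : surface R g b) : R := (set_val s).1.1.
Let sy (s : surface R g b) : R := (set_val s).1.2.
Let sz (s : surface R g b) : R := (set_val s).2.

Lemma surface_coord_continuous : [/\ continuous sx, continuous sy & continuous sz].
Proof.
have c1 : continuous (fun s : surface R g b => (set_val s).1).
  by apply: (continuous_compose (g := fst)); [exact: continuous_fst|exact: set_val_continuous].
split.
- by apply: (continuous_compose (g := fst)) => //; exact: continuous_fst.
- by apply: (continuous_compose (g := snd)) => //; exact: continuous_snd.
- by apply: (continuous_compose (g := snd)); [exact: continuous_snd|exact: set_val_continuous].
Qed.

(** A nowhere zero map to the plane, built from the gauge and [y], is projected radially to the
    circle; on the rim of hole [i] it is the translation of that rim to the origin. *)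
Lemma surface_to_boundary_circle (i j : 'I_b) : i != j ->
  exists2 phi : surface R g b -> circle R, continuous phi &
    forall s, surface_boundary i s ->
      set_val (phi s) = (sx s + hole_pos i, sy s).
Proof.
move=> ij; have [cx cy cz] := surface_coord_continuous.
pose n := hole_pos i; pose m := hole_pos j.
pose u s := segment_gauge n m (sx s) (sy s).
have cu : continuous u by exact: segment_gauge_continuous.
have u0 s : sz s = 0 -> 0 < u s.
  move=> z0; apply: surface_gauge_gt0 => //.
  have zs : sz s ^+ 2 = surface_poly g b (sx s) (sy s) := proj1 (set_valP s).
  by rewrite -zs z0 expr2 mulr0.
(* The map (u, y) would vanish on the lower sheet below the two hole centres;
subtracting z keeps its first component positive there. *)
pose w s := if sz s <= 0 then `|u s| - sz s else u s.
have cw : continuous w.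
  apply: paste_continuous => //.
    by apply: continuousR_sub => //; exact: continuousR_norm.
  by move=> s z0; rewrite z0 subr0 gtr0_norm ?u0.
(* This sign turns the value [- (x + n)] of the gauge on the rim into [x + n] when the segment
   leaves hole [i] to the right. *)
pose e : R := if n < m then 1 else -1.
have e0 : e != 0 by rewrite /e; case: ifP; rewrite ?oppr_eq0 oner_eq0.
have [|//||phi cphi phiE] := @continuous_normalize _ (fun s => e * w s) sy.
- by apply: continuousR_mul => //; exact: continuousR_cst.
- move=> s [/eqP]; rewrite mulf_eq0 (negbTE e0) /= /w => + y0.
  case: leP => [z0|z0] /eqP.
    (* Both [|u s|] and [- sz s] are nonnegative here, so they vanish together, against the
       positivity of [u] where the sheets meet. *)
    have h := normr_ge0 (u s); have [z1|z1] := eqVneq (sz s) 0.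
      by rewrite z1 subr0 => /normr0_eq0; have := u0 _ z1; lra.
    by move: z0 h z1; rewrite le_eqVlt => /orP[-> //|]; lra.
  (* On the upper sheet a zero could only lie at one of the two hole centres, and these have been
     removed from the surface. *)
  rewrite /u y0 => /segment_gauge_eq0 xc.
  have [k xk] : exists k : 'I_b, sx s = - hole_pos k.
    by case: xc => ->; [exists i|exists j].
  have : 1 <= (sx s + hole_pos k) ^+ 2 + sy s ^+ 2 := proj2 (set_valP s) k z0.
  by rewrite xk y0 addNr expr2 mul0r add0r; lra.
- exists phi => // s [z0 d]; have z1 : 0 < sz s := z0.
  have d1 : (sx s + hole_pos i) ^+ 2 + sy s ^+ 2 = 1 := d.
  have E : e * w s = sx s + hole_pos i.
    rewrite /w leNgt z1 /= /u segment_gauge_circle ?hole_pos_dist // /e.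
    by case: ifP; rewrite ?mul1r // mulrNN mul1r.
  by rewrite phiE E.
Qed.

(** Over the rim, the upper sheet is the graph of the positive square root of [surface_poly]. The
    last clause says that [psi] inverts the planar coordinates taken relative to the hole centre. *)
Lemma surface_boundary_circle (i : 'I_b) :
  exists psi : circle R -> surface R g b, [/\ continuous psi,
    forall c, surface_boundary i (psi c) &
    forall s c, surface_boundary i s ->
      set_val c = (sx s + hole_pos i, sy s) -> psi c = s].
Proof.
pose X (c : circle R) : R := (set_val c).1 - hole_pos i.
pose Y (c : circle R) : R := (set_val c).2.
pose Z (c : circle R) : R := Num.sqrt (surface_poly g b (X c) (Y c)).
have d1 c : (X c + hole_pos i) ^+ 2 + Y c ^+ 2 = 1.
  by rewrite subrK; exact: set_valP c.
have P0 c := surface_poly_gt0 (d1 c).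
have Z0 c : 0 < Z c by rewrite sqrtr_gt0.
have S c : [set p : R * R * R | p.2 ^+ 2 = surface_poly g b p.1.1 p.1.2 /\
    forall j : 'I_b, 0 < p.2 -> 1 <= hole_dist2 j p] (X c, Y c, Z c).
  by split => /= [|j _]; [rewrite sqr_sqrtr // ltW|exact: hole_dist2_ge1].
exists (fun c => exist (fun p => p \in _) _ (mem_set (S c))); split.
- have cX : continuous X.
    apply: continuousR_sub; last exact: continuousR_cst.
    apply: (continuous_compose (g := fst)); first exact: continuous_fst.
    exact: set_val_continuous.
  have cY : continuous Y.
    apply: (continuous_compose (g := snd)); first exact: continuous_snd.
    exact: set_val_continuous.
  apply: continuous_set_type; apply: continuous_pair; first exact: continuous_pair.
  apply: (continuous_compose (g := @Num.sqrt R)); first exact: sqrt_continuous.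
  have cc (k : R) := @continuousR_cst R (circle R) k.
  apply: continuousR_mul.
    apply: continuousR_sub; last exact: continuousR_mul.
    by apply: continuousR_sub => //; exact: continuousR_mul.
  apply: continuousR_prod => k; apply: continuousR_sub => //.
  apply: continuousR_add; last exact: continuousR_mul.
  by apply: continuousR_mul; apply: continuousR_sub.
- by move=> c; split; [exact: Z0|exact: d1].
- move=> s c [z0 _] cE; apply: val_inj => /=.
  have XE : X c = sx s by rewrite /X cE addrK.
  have YE : Y c = sy s by rewrite /Y cE.
  have zs : sz s ^+ 2 = surface_poly g b (sx s) (sy s) := proj1 (set_valP s).
  have ZE : Z c = sz s.
    by rewrite /Z XE YE -zs sqrtr_sqr gtr0_norm.
  by rewrite XE YE ZE -[RHS]/(set_val s) /sx /sy /sz; case: (set_val s) => -[].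
Qed.

(** The second hole is essential: a sole boundary circle of a compact orientable surface bounds in
    homology, so it is not a retract. *)
Lemma surface_boundary_retraction (i j : 'I_b) : i != j ->
  exists r : surface R g b -> surface R g b, [/\ continuous r,
    forall s, surface_boundary i (r s) & forall s, surface_boundary i s -> r s = s].
Proof.
move=> /surface_to_boundary_circle[phi cphi phiE].
have [psi [cpsi psi_bd psiK]] := surface_boundary_circle i.
exists (psi \o phi); split => [|s|s bs]; first exact: continuous_compose.
  exact: psi_bd.
by apply: psiK => //; exact: phiE.
Qed.

Lemma surface_boundary_range (i : 'I_b) :
  exists2 psi : circle R -> surface R g b, continuous psi & range psi = surface_boundary i.
Proof.
have [psi [cpsi psi_bd psiK]] := surface_boundary_circle i.
exists psi => //; apply/seteqP; split => [_ [c _ <-]//|s bs].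
by have [_ d1] := bs; exists (@mk_circle R (sx s + hole_pos i, sy s) d1) => //; exact: psiK.
Qed.

End SurfaceRetraction.

(** * Embeddings, pasting and induced maps *)

(** A total left inverse of an embedding: off the range it takes the default value [x0], so
    continuity is claimed within the range only. *)
Lemma embedding_retraction (X Y : topologicalType) (f : X -> Y) (x0 : X) :
  is_embedding f ->
  exists2 g : Y -> X, {within range f, continuous g} & forall x, g (f x) = x.
Proof.
move=> [cf injf openf].
pose g (y : Y) := if pselect (exists x, f x = y) is left e then projT1 (cid e) else x0.
have gK x : g (f x) = x.
  rewrite /g; case: pselect => [e|[]]; last by exists x.
  by apply: injf; exact: projT2 (cid e).
exists g => //; apply/subspace_continuousP => _ [x _ <-].
have -> : from_subspace (range f) g (f x) = x by exact: gK.
move=> U; rewrite {1}nbhsE => -[W [oW Wx] WU]; have [V oV WV] := openf _ oW.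
have nV : nbhs (f x) V by apply: open_nbhs_nbhs; split => //; move: Wx; rewrite WV.
suff : nbhs (f x) [set y | range f y -> U (g y)] by [].
apply: filterS nV => y Vy [z _ zy]; rewrite -zy gK; apply: WU.
by rewrite WV /= zy.
Qed.

Lemma embedding_comp (X Y Z : topologicalType) (f : X -> Y) (g : Y -> Z) :
  is_embedding f -> is_embedding g -> is_embedding (g \o f).
Proof.
move=> [cf injf openf] [cg injg openg]; split.
- exact: continuous_compose.
- exact: inj_comp.
- by move=> _ /openf[_ /openg[V oV ->] ->]; exists V.
Qed.

Lemma homeomorphism_embedding (X Y : topologicalType) (f : X -> Y) :
  is_homeomorphism f -> is_embedding f.
Proof.
move=> [g [cf cg fK gK]]; split => //; first exact: can_inj fK.
move=> U oU; exists (g @^-1` U); first by move/continuousP: cg; exact.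
by apply/seteqP; split => x /=; rewrite fK.
Qed.

Lemma set_incl_embedding (X : topologicalType) (A : set X) :
  is_embedding (@set_incl X A).
Proof.
split; [exact: set_val_continuous|exact: val_inj|].
by move=> U [V oV <-]; exists V.
Qed.

Lemma range_set_incl (X : topologicalType) (A : set X) : range (@set_incl X A) = A.
Proof.
apply/seteqP; split => [_ [a _ <-]|x Ax]; first exact: (set_valP a).
by exists (exist (fun y => y \in A) x (mem_set Ax)).
Qed.

Lemma within_paste (X Y : topologicalType) (A B : set X) (f g : X -> Y) :
  closed A -> closed B -> {within A, continuous f} -> {within B, continuous g} ->
  (forall x, A x -> B x -> f x = g x) ->
  exists h : X -> Y, [/\ {within A `|` B, continuous h},
    forall x, A x -> h x = f x & forall x, B x -> h x = g x].
Proof.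
move=> cA cB cf cg fg; pose h x := if pselect (A x) is left _ then f x else g x.
have hA x : A x -> h x = f x by rewrite /h; case: pselect.
have hB x : B x -> h x = g x by rewrite /h; case: pselect => // Ax Bx; exact: fg.
exists h; split => //; apply: withinU_continuous => //.
  by apply: subspace_eq_continuous cf => x; rewrite inE => Ax; exact: esym (hA _ Ax).
by apply: subspace_eq_continuous cg => x; rewrite inE => Bx; exact: esym (hB _ Bx).
Qed.

(** The base points [f x] and [y] agree only by a hypothesis, so the homomorphism is described
    through pointwise equal loops; this avoids transport between the two fundamental groups. *)
Lemma pi1_map_to (R : realType) (X Y : topologicalType) (f : continuousType X Y)
    (x : X) (y : Y) : f x = y ->
  exists r : {multiplicative pi1 R x -> pi1 R y},
    forall (p : {path unitI R from x to x in X}) (q : {path unitI R from y to y in Y}),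
      (forall t, f (p t) = q t) -> r (pi1_class p) = pi1_class q.
Proof.
case: y / => /=; pose h := isMultiplicative.Build _ _ _ (@pi1_mapM R X Y f x).
pose r : {multiplicative pi1 R x -> pi1 R (f x)} := HB.pack (@pi1_map R X Y f x) h.
exists r => p q pq; rewrite [LHS](pi1_map_class f p); congr pi1_class.
exact/path_eqP.
Qed.

(** * Subtrees *)

Definition subgraph (T : finType) (e : rel T) (K : {set T}) : rel T :=
  fun a b => [&& a \in K, b \in K & e a b].

(** Otherwise a simple path in [K] from [u] to [u'], closed up through [w], would be a cycle of
    length at least 3. *)
Lemma tree_neighbour_uniq (T : finType) (e : rel T) (K : {set T}) (w u u' : T) :
  is_tree e -> symmetric e -> {in K &, forall a b, connect (subgraph e K) a b} ->
  w \notin K -> u \in K -> u' \in K -> e w u -> e w u' -> u = u'.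
Proof.
move=> [_ acyclic] esym Kconn wK uK u'K wu wu'.
have /connectP[p0 p0P lp0] := Kconn _ _ uK u'K.
move: lp0; case/shortenP: p0P => p pP up _ lp.
have pK : {subset u :: p <= K}.
  elim: p u uK pP {wu up lp} => [|y p IH] x xK /=.
    by move=> _ z; rewrite inE => /eqP->.
  by case/andP=> /and3P[_ yK _] /(IH _ yK) pK z; rewrite inE => /predU1P[->|/pK].
(* Cycles of size 2 are edges run back and forth and are allowed; the bound forces [p] to be
   empty. *)
have : (size [:: w, u & p] <= 2)%N.
  apply: acyclic; apply/andP; split; last first.
    by rewrite cons_uniq up andbT; apply: contra wK => /pK.
  rewrite /= wu rcons_path -lp esym wu' andbT.
  by apply: sub_path pP => a b /and3P[].
by case: p lp {pP up pK}.
Qed.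

Lemma connected_subgraph_extend (T : finType) (e : rel T) (K : {set T}) (w u : T) :
  symmetric e -> {in K &, forall a b, connect (subgraph e K) a b} ->
  u \in K -> e w u ->
  {in w |: K &, forall a b, connect (subgraph e (w |: K)) a b}.
Proof.
move=> esym Kconn uK wu.
have Ksym : connect_sym (subgraph e (w |: K)).
  by apply: sym_connect_sym => a b; rewrite /subgraph esym andbCA.
have toK a : a \in w |: K -> connect (subgraph e (w |: K)) a u.
  case/setU1P=> [->|aK].
    by apply: connect1; rewrite /subgraph wu !inE eqxx uK orbT.
  apply: connect_sub (Kconn _ _ aK uK) => x y /and3P[xK yK xy].
  by apply: connect1; rewrite /subgraph xy !inE xK yK !orbT.
by move=> a b aK bK; apply: connect_trans (toK a aK) _; rewrite Ksym; exact: toK.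
Qed.

Lemma connect_exit (T : finType) (e : rel T) (K : {set T}) (v w : T) :
  v \in K -> w \notin K -> connect e v w -> exists a b, [/\ a \in K, b \notin K & e a b].
Proof.
move=> vK wK /connectP[p pP lp]; elim: p v vK pP lp => [|y p IH] x xK /=.
  by move=> _ wx; rewrite wx xK in wK.
move=> /andP[xy yp] lp; have [yK|yK] := boolP (y \in K); first exact: IH yp lp.
by exists x, y.
Qed.

(** * Blocks, collars and boundary tori *)

Section GraphManifold.
Variables (R : realType) (M : topologicalType) (D : graph_manifold R M).
Local Notation V := (gm_vertex D).
Local Notation E := (gm_edge D).
Local Notation block := (@gm_block R M D).
Local Notation collar := (@gm_collar R M D).
Implicit Types (i : E) (s : bool) (w : V).

Let JSJ := gm_JSJ D.
Let M_hausdorff : hausdorff_space M := proj1 (gm_oriented D).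

(** One of the two parallel copies of a JSJ torus that bound its collar; [~~ s] is the opposite
    side. *)
Definition edge_end i s : set M := slice (collar i) (if s then 1 else -1).

Lemma edge_endE i s : edge_end i s = range (fun t => collar i (t, sym_end R s)).
Proof.
apply/seteqP; split => [_ [[t a] /= a1 <-]|_ [t _ <-]]; last by exists (t, sym_end R s).
by exists t => //; congr (collar i (t, _)); apply: val_inj.
Qed.

Lemma collar_continuous i : continuous (collar i).
Proof. by case: (JSJ_embedding JSJ i). Qed.

Lemma collar_inj i : injective (collar i).
Proof. by case: (JSJ_embedding JSJ i). Qed.

Lemma collar_disjoint i j p q : collar i p = collar j q -> i = j.
Proof.
move=> ij; apply/eqP; apply: contraT => /(JSJ_disjoint JSJ); rewrite -subset0.
by move=> /(_ (collar i p)); case; split; [exists p|exists q].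
Qed.

Lemma collar_end_continuous i s : continuous (fun t => collar i (t, sym_end R s)).
Proof.
apply: (continuous_compose (g := collar i)); first exact: collar_continuous.
by apply: continuous_pair => // t; [exact: cvg_id|exact: cst_continuous].
Qed.

Lemma edge_end_closed i s : closed (edge_end i s).
Proof.
apply: compact_closed => //; rewrite edge_endE; apply: continuous_compact.
  by apply: continuous_subspaceT; exact: collar_end_continuous.
exact: torus_compact.
Qed.

Lemma edge_end_connected i s : connected (edge_end i s).
Proof.
rewrite edge_endE; apply: connected_continuous_connected; first exact: torus_connected.
by apply: continuous_subspaceT; exact: collar_end_continuous.
Qed.

Let base : torus R := (circle_angle (0 : R), circle_angle (0 : R)).

Lemma edge_end_nonempty i s : edge_end i s !=set0.
Proof. by rewrite edge_endE; exists (collar i (base, sym_end R s)); exists base. Qed.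

Lemma edge_end_disjoint i j s s' : (i, s) != (j, s') ->
  edge_end i s `&` edge_end j s' = set0.
Proof.
move=> ne; rewrite !edge_endE -subset0 => _ [[t _ <-] [t' _ e]].
move: (e) ne => /collar_disjoint ij; subst j; move: e => /collar_inj[_].
move=> ss; rewrite xpair_eqE eqxx /= => /negP; apply.
by case: s s' ss => -[] // ss; exfalso; move: ss; lra.
Qed.

Lemma range_collar_closed i : closed (range (collar i)).
Proof.
apply: compact_closed => //; apply: continuous_compact.
  by apply: continuous_subspaceT; exact: collar_continuous.
by rewrite -setXTT; apply: compact_setX; [exact: torus_compact|exact: symI_compact].
Qed.

Lemma cut_along_closed : closed (cut_along collar [set: E]).
Proof.
by apply: open_closedC; apply: bigcup_open => i _; exact: JSJ_open.
Qed.

Lemma cut_along_collar i t a : cut_along collar [set: E] (collar i (t, a)) ->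
  exists s, a = sym_end R s.
Proof.
have := set_valP a; rewrite /= in_itv /= => /andP[a0 a1] h.
have [aN|aN] := eqVneq (set_val a) (-1); first by exists false; apply: val_inj.
have [aP|aP] := eqVneq (set_val a) 1; first by exists true; apply: val_inj.
case: h; exists i; first by rewrite /= inE.
by exists (t, a) => //=; rewrite !lt_neqAle a0 a1 eq_sym aN aP.
Qed.

Lemma edge_end_cut i s : edge_end i s `<=` cut_along collar [set: E].
Proof.
rewrite edge_endE => _ [t _ <-] [j _ [[t' a] /= a1 e]].
move: (e) => /collar_disjoint ij; subst j; move: e => /collar_inj[_ e].
by move: a1; rewrite e /=; case: s {e}; rewrite /= ltxx ?andbF.
Qed.

Lemma block_piece w : pieces collar [set: E]%SET (block w).
Proof. by rewrite -(gm_blocks D); exists w. Qed.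

Lemma block_closed w : closed (block w).
Proof.
by have [x _ ->] := block_piece w; apply: component_closed; exact: cut_along_closed.
Qed.

Lemma block_cut w : block w `<=` cut_along collar [set: E].
Proof. by have [x _ ->] := block_piece w; exact: connected_component_sub. Qed.

Lemma block_component w x : block w x ->
  block w = connected_component (cut_along collar [set: E]%SET) x.
Proof. by have [y _ ->] := block_piece w; exact: same_connected_component. Qed.

Lemma block_disjoint w w' x : block w x -> block w' x -> w = w'.
Proof.
move=> /block_component wx /block_component w'x; apply: (@gm_block_inj _ _ D).
by rewrite wx w'x.
Qed.

Lemma cut_block x : cut_along collar [set: E]%SET x -> exists w, block w x.
Proof.
move=> Cx; have : pieces collar [set: E]%SET
    (connected_component (cut_along collar [set: E]%SET) x) by exists x.
rewrite -(gm_blocks D) => -[w _ wE]; exists w; rewrite wE.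
exact: connected_component_refl.
Qed.

Lemma block_or_collar x : (exists w, block w x) \/ (exists i, range (collar i) x).
Proof.
have [/cut_block|/contrapT[i _ [p _ <-]]] := pselect (cut_along collar [set: E]%SET x).
  by left.
by right; exists i; exists p.
Qed.

(** The end is connected and survives the cutting, so it lies in a single component, and the
    components are the blocks. *)
Lemma edge_block_ex i s : exists w, edge_end i s `<=` block w.
Proof.
have [x ex] := edge_end_nonempty i s; have [w wx] := cut_block (edge_end_cut ex).
exists w; rewrite (block_component wx); apply: connected_component_max => //.
  exact: edge_end_cut.
exact: edge_end_connected.
Qed.

Definition edge_block i s : V := projT1 (cid (edge_block_ex i s)).

Lemma edge_block_sub i s : edge_end i s `<=` block (edge_block i s).
Proof. exact: projT2 (cid (edge_block_ex i s)). Qed.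

Lemma edge_block_uniq i s w : edge_end i s `<=` block w -> w = edge_block i s.
Proof.
have [x ex] := edge_end_nonempty i s => /(_ x ex) wx.
by apply: block_disjoint wx _; exact: edge_block_sub ex.
Qed.

Lemma block_collar w i t a : block w (collar i (t, a)) ->
  exists2 s, a = sym_end R s & w = edge_block i s.
Proof.
move=> wx; have [s as_] := cut_along_collar (block_cut wx); exists s => //.
apply: block_disjoint wx _; apply: edge_block_sub.
by rewrite edge_endE as_; exists t.
Qed.

Lemma gm_joins_edge i s : gm_joins i (edge_block i s) (edge_block i (~~ s)).
Proof.
have h0 := @edge_block_sub i false; have h1 := @edge_block_sub i true.
by case: s; [right|left].
Qed.

Lemma dual_graphP w w' : reflect
  (exists i s, w = edge_block i s /\ w' = edge_block i (~~ s)) (dual_graph D w w').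
Proof.
rewrite /dual_graph; apply: (iffP (asboolP _)) => [[i [[h1 h2]|[h1 h2]]]|[i [s [-> ->]]]].
- by exists i, false; split; exact: edge_block_uniq.
- by exists i, true; split; exact: edge_block_uniq.
- by exists i; exact: gm_joins_edge.
Qed.

Definition block_param w : surface R (gm_genus w) (gm_holes w) * circle R -> M :=
  @set_incl M (block w) \o @gm_bundle R M D w.

Lemma block_param_embedding w : is_embedding (@block_param w).
Proof.
apply: embedding_comp; last exact: set_incl_embedding.
by apply: homeomorphism_embedding; exact: gm_bundleP.
Qed.

Lemma range_block_param w : range (@block_param w) = block w.
Proof.
have [h [_ _ _ hK]] := @gm_bundleP R M D w.
rewrite -[RHS]range_set_incl; apply/seteqP; split => _ [q _ <-]; first by exists (gm_bundle q).
by exists (h q) => //; rewrite /block_param /= hK.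
Qed.

Lemma boundary_torusE w (j : 'I_(gm_holes w)) :
  boundary_torus j = @block_param w @` [set q | surface_boundary j q.1].
Proof. by []. Qed.

(** Being a continuous image of the torus, a boundary torus is compact and connected, hence closed
    in the Hausdorff space [M]. *)
Lemma boundary_torus_range w (j : 'I_(gm_holes w)) :
  exists2 f : torus R -> M, continuous f & range f = boundary_torus j.
Proof.
have [psi cpsi psiE] := @surface_boundary_range R (gm_genus w) (gm_holes w) j.
have [cb _ _] := block_param_embedding w.
exists (fun c => block_param (psi c.1, c.2)).
  apply: (continuous_compose (g := @block_param w)) => //; apply: continuous_pair.
    by apply: (continuous_compose (g := psi)) => //; exact: continuous_fst.
  exact: continuous_snd.
rewrite boundary_torusE; apply/seteqP; split => [_ [[c d] _ <-]|_ [[a d] /= aj <-]].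
  by exists (psi c, d) => //=; rewrite -psiE; exists c.
by move: aj; rewrite -psiE => -[c _ <-]; exists (c, d).
Qed.

Lemma boundary_torus_closed w (j : 'I_(gm_holes w)) : closed (boundary_torus j).
Proof.
have [f cf <-] := boundary_torus_range j; apply: compact_closed => //.
apply: continuous_compact; first exact: continuous_subspaceT.
exact: torus_compact.
Qed.

Lemma boundary_torus_connected w (j : 'I_(gm_holes w)) : connected (boundary_torus j).
Proof.
have [f cf <-] := boundary_torus_range j.
apply: connected_continuous_connected; first exact: torus_connected.
exact: continuous_subspaceT.
Qed.

Lemma boundary_torus_disjoint w (j k : 'I_(gm_holes w)) : j != k ->
  boundary_torus j `&` boundary_torus k = set0.
Proof.
move=> jk; rewrite !boundary_torusE -subset0 => _ [[q /= [_ qj] <-] [q' /= qk e]].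
have [_ /(_ _ _ e) qq _] := block_param_embedding w; subst q'; case: qk => _ qk.
(* A common point would have its x-coordinate within 1 of two hole centres that are at least 3
   apart. *)
have /andP[] := sqr_sum1_bound qj; have /andP[] := sqr_sum1_bound qk.
rewrite -!/(hole_pos R _); have := hole_pos_dist R jk.
by case: ger0P; clear; lra.
Qed.

Lemma block_boundary w : \bigcup_j boundary_torus (j : 'I_(gm_holes w)) =
  block w `&` (manifold_boundary R (X := M) `|`
    \bigcup_i (edge_end i false `|` edge_end i true)).
Proof.
rewrite -[RHS](@gm_bundle_boundary R M D w); apply/seteqP; split.
  by move=> _ [j _ [q qj <-]]; exists q => //; exists j.
by move=> _ [q [j qj] <-]; exists j => //; exists q.
Qed.

Lemma manifold_boundary_closed : closed (manifold_boundary R (X := M)).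
Proof.
apply: open_closedC; rewrite openE => x; case=> U [W [oU Ux oW f]].
rewrite /interior nbhsE; exists U => //.
by move=> y Uy; exists U, W; split.
Qed.

Lemma manifold_boundary_edge_end i s : manifold_boundary R (X := M) `&` edge_end i s = set0.
Proof.
rewrite -subset0 edge_endE => x [bx [t _ tx]]; apply: bx.
by apply: (JSJ_interior JSJ (i := i)); rewrite -tx; exists (t, sym_end R s).
Qed.

(** Connectedness is used twice: the end lies in one of the disjoint boundary tori of the block, and
    that torus lies in one of the disjoint closed sets formed by the ends and the boundary of
    [M]. *)
Lemma edge_end_boundary_torus w i s : edge_end i s `<=` block w ->
  exists j : 'I_(gm_holes w), edge_end i s = boundary_torus j.
Proof.
move=> ew; have eb : edge_end i s `<=` \bigcup_j boundary_torus (j : 'I_(gm_holes w)).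
  move=> x ex; rewrite block_boundary; split; first exact: ew.
  by right; exists i => //; case: s ex {ew}; [right|left].
have [x ex] := edge_end_nonempty i s; have [j _ jx] := eb x ex.
exists j; apply/seteqP; split.
  apply: connected_sub_disjoint_closed eb _ => //.
  - exact: boundary_torus_closed.
  - exact: boundary_torus_disjoint.
  - exact: edge_end_connected.
  - by exists x.
(* [None] stands for the boundary of [M], which is disjoint from every collar. *)
pose F (o : option (E * bool)) : set M :=
  if o is Some p then edge_end p.1 p.2 else manifold_boundary R (X := M).
apply: (@connected_sub_disjoint_closed _ _ F _ (Some (i, s))).
- by case=> [p|]; [exact: edge_end_closed|exact: manifold_boundary_closed].
- case=> [p|] [p'|] //= pp; last 2 first.
  + by rewrite setIC manifold_boundary_edge_end.
  + exact: manifold_boundary_edge_end.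
  by apply: edge_end_disjoint; move: pp; case: p p' => [? ?] [? ?].
- exact: boundary_torus_connected.
- move=> y jy; have : (\bigcup_j boundary_torus (j : 'I_(gm_holes w))) y by exists j.
  rewrite block_boundary => -[_ [by_|[k _ [ky|ky]]]]; first by exists None.
    by exists (Some (k, false)).
  by exists (Some (k, true)).
- by exists x.
Qed.

(** At an end vertex the second torus is one in the boundary of [M]; at any other vertex it comes
    from an edge to a second neighbour. *)
Lemma other_hole w i s (Hirr : forall w, ~~ dual_graph D w w)
    (Hend : forall w, valence (dual_graph D) w = 1%N ->
       exists j : 'I_(gm_holes w), boundary_component R (boundary_torus j))
    (j : 'I_(gm_holes w)) :
  edge_end i s = boundary_torus j -> exists k, k != j.
Proof.
move=> ej; have ew : edge_end i s `<=` block w.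
  have [f _ _] := boundary_torus_range j; rewrite ej -(range_block_param w).
  by move=> _ [q _ <-]; exists q.
have wE := edge_block_uniq ew; pose u := edge_block i (~~ s).
have [v1|v1] := eqVneq (valence (dual_graph D) w) 1%N.
  have [k [x bx kE]] := Hend w v1; exists k; apply/eqP => kj; subst k.
  have : boundary_torus j x by rewrite kE; exact: connected_component_refl.
  rewrite -ej => ex; have := manifold_boundary_edge_end i s; rewrite -subset0.
  by move=> /(_ x); apply.
have [u' wu' uu'] : exists2 u', dual_graph D w u' & u' != u.
  (* The block [u] across the collar is a neighbour; were it the only one, the valence would be
     one. *)
  apply: contrapT => H; case/eqP: v1; rewrite /valence.
  rewrite (_ : [set _ | _]%SET = [set u]%SET) ?cards1 //; apply/setP => y.
  rewrite !inE; apply/idP/eqP => [wy|->]; last by apply/dual_graphP; exists i, s.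
  by apply/eqP; apply: contraT => yu; case: H; exists y.
have [i' [s' [wE' uE']]] := dual_graphP _ _ wu'.
have ew' : edge_end i' s' `<=` block w by rewrite wE'; exact: edge_block_sub.
have [k ek] := edge_end_boundary_torus ew'; exists k; apply/eqP => kj; subst k.
(* The two ends differ because the blocks across them do. *)
have ne : (i, s) != (i', s').
  by apply: contra uu' => /eqP[ii ss]; rewrite uE' -ii -ss.
have [x ex] := edge_end_nonempty i s; have := edge_end_disjoint ne.
by rewrite ek -ej setIid -subset0 => /(_ x); apply.
Qed.

(** Pass to bundle coordinates, retract the base surface onto the circle of [j] while keeping the
    fibre coordinate, and read off the torus coordinate of the collar end reached. *)
Lemma block_retraction w i s (j k : 'I_(gm_holes w)) : k != j ->
  edge_end i s = boundary_torus j ->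
  exists2 theta : M -> torus R, {within block w, continuous theta} &
    forall t, theta (collar i (t, sym_end R s)) = t.
Proof.
rewrite eq_sym => kj ej.
have [r [cr rj rK]] := @surface_boundary_retraction R (gm_genus w) (gm_holes w) _ _ kj.
(* Only supplies the point [q0], the default value of the inverse [h] of the bundle
   parametrization. *)
have [x0 ex0] := edge_end_nonempty i s; move: (ex0); rewrite ej => -[q0 _ _].
have [cb _ _] := block_param_embedding w.
have [h ch hK] := embedding_retraction q0 (block_param_embedding w).
have [c' cc' c'K] := embedding_retraction (base, sym_end R s) (JSJ_embedding JSJ i).
pose rr (q : surface R (gm_genus w) (gm_holes w) * circle R) := block_param (r q.1, q.2).
have crr : continuous rr.
  apply: (continuous_compose (g := @block_param w)) => //; apply: continuous_pair.
    by apply: (continuous_compose (g := r)) => //; exact: continuous_fst.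
  exact: continuous_snd.
exists (fst \o c' \o (rr \o h)).
  apply: (within_comp (B := range (collar i))).
  - apply: (within_comp (B := setT)) => //; first by rewrite -range_block_param.
    exact: continuous_subspaceT.
  - apply: (within_comp (B := setT)) => //.
    by apply: continuous_subspaceT; exact: continuous_fst.
  - move=> _ [x _ <-]; have : edge_end i s ((rr \o h) x).
      by rewrite ej; exists (r (h x).1, (h x).2) => //; exact: rj.
    by rewrite edge_endE => -[t _ <-]; exists (t, sym_end R s).
move=> t /=; have : edge_end i s (collar i (t, sym_end R s)) by rewrite edge_endE; exists t.
rewrite ej => -[[a c] /= aj e]; rewrite -e -[set_incl _]/(block_param (a, c)) hK /rr /= rK //.
by rewrite [block_param _]e c'K.
Qed.

(** * Collapsing the tree *)

Lemma dual_graph_sym : symmetric (dual_graph D).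
Proof.
suff H w w' : dual_graph D w w' -> dual_graph D w' w by move=> w w'; apply/idP/idP; exact: H.
move=> /dual_graphP[i [s [-> ->]]]; apply/dual_graphP.
by exists i, (~~ s); rewrite negbK.
Qed.

(** Collars with just one end in [K] are left out, so that the collar of a newly attached block is
    free to carry the extension. *)
Definition subgraph_space (K : {set V}) : set M :=
  \bigcup_(w in [set w | w \in K]) block w `|`
  \bigcup_(i in [set i | forall s, edge_block i s \in K]) range (collar i).

Lemma subgraph_space_closed K : closed (subgraph_space K).
Proof.
apply: closedU; apply: closed_bigcup => *; first exact: finite_finset.
- exact: block_closed.
- exact: finite_finset.
- exact: range_collar_closed.
Qed.

(** A new block is attached along a single collar: the tree gives it one neighbour in [K], and
    simplicity gives one edge to that neighbour. *)
Lemma edge_into_subtree (K : {set V}) (i i' : E) (s s' : bool) :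
  dual_graph_simple D -> is_tree (dual_graph D) ->
  {in K &, forall a b, connect (subgraph (dual_graph D) K) a b} ->
  edge_block i s \notin K -> edge_block i s = edge_block i' s' ->
  edge_block i (~~ s) \in K -> edge_block i' (~~ s') \in K -> i = i'.
Proof.
move=> [_ simple] tree Kconn wK ww' uK u'K.
apply: (simple _ _ _ _ (gm_joins_edge i s)).
rewrite ww' (_ : edge_block i (~~ s) = edge_block i' (~~ s')); first exact: gm_joins_edge.
apply: (tree_neighbour_uniq tree dual_graph_sym Kconn wK) => //.
  by apply/dual_graphP; exists i, s.
by apply/dual_graphP; exists i', s'.
Qed.

(** The new block and its collar are first sent to the torus by a map [g]; its value is then placed
    at the far end of the collar, where [f] is already defined. *)
Lemma extend_subgraph_map (Y : topologicalType) (K : {set V}) (f : M -> Y) i s :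
  dual_graph_simple D -> is_tree (dual_graph D) ->
  (forall w, valence (dual_graph D) w = 1%N ->
    exists j : 'I_(gm_holes w), boundary_component R (boundary_torus j)) ->
  {in K &, forall a b, connect (subgraph (dual_graph D) K) a b} ->
  edge_block i s \notin K -> edge_block i (~~ s) \in K ->
  {within subgraph_space K, continuous f} ->
  exists2 f' : M -> Y,
    {within subgraph_space (edge_block i s |: K), continuous f'} &
    forall x, subgraph_space K x -> f' x = f x.
Proof.
move=> simple tree Hend Kconn wK uK cf.
set w := edge_block i s in wK *.
(* The opposite end of the collar lies in a block of [K], so only the end [s] touches [w]; there
   [theta] and the collar projection must agree. *)
have endE s1 : edge_block i s1 = w -> s1 = s.
  move=> s1w; apply/eqP; apply: contraNT wK => s1s; rewrite -s1w.
  by case: s s1 uK s1s {s1w w} => -[].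
have [j ej] := edge_end_boundary_torus (@edge_block_sub i s).
have [k kj] := other_hole (proj1 simple) Hend ej.
have [theta ctheta thetaK] := block_retraction kj ej.
have [c cc cK] := embedding_retraction (base, sym_end R s) (JSJ_embedding JSJ i).
have [|x wx [[t a] _ xE]|g [cg gw gc]] :=
  within_paste (@block_closed w) (@range_collar_closed i) ctheta (g := fst \o c).
- apply: (within_comp (B := setT)) => //.
  by apply: continuous_subspaceT; exact: continuous_fst.
- move: wx; rewrite -xE => /block_collar[s1 -> /esym/endE ->].
  by rewrite thetaK /= cK.
have gcE t a : g (collar i (t, a)) = t by rewrite gc /= ?cK //; exists (t, a).
pose P := block w `|` range (collar i).
have cP : closed P by apply: closedU; [exact: block_closed|exact: range_collar_closed].
pose slide t := collar i (t, sym_end R (~~ s)).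
have slideK t : subgraph_space K (slide t).
  left; exists (edge_block i (~~ s)) => //; apply: edge_block_sub.
  by rewrite edge_endE; exists t.
have [|x Kx Px|f' [cf' f'K _]] :=
    within_paste (@subgraph_space_closed K) cP cf (g := f \o (slide \o g)).
- apply: (within_comp (B := subgraph_space K)) => //.
    apply: (within_comp (B := setT)) => //.
    by apply: continuous_subspaceT; exact: collar_end_continuous.
  by move=> _ [x _ <-]; exact: slideK.
(* The old and new parts meet only in the far end of the collar, where [slide \o g] is the
   identity. *)
- congr f => /=; case: Px Kx => [wx|[[t a] _ <-]].
    case=> [[b /= bK bx]|[k' /= k'K [[t a] _ xE]]].
      by move: wK; rewrite (block_disjoint wx bx) bK.
    by move: wx wK; rewrite -xE => /block_collar[s1 _ ->]; rewrite k'K.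
  rewrite gcE; case=> [[b /= bK /block_collar[s1 -> bE]]|[k' /= k'K [q _ e]]].
    suff -> : s1 = ~~ s by [].
    by move: bK; rewrite bE; move: wK; rewrite /w; case: (s) s1 {bE} => -[] // /negbTE->.
  by move: wK; rewrite /w -(collar_disjoint e) k'K.
exists f' => //; apply: continuous_subspaceW cf' => x.
case=> [[b /= /setU1P[-> bx|bK bx]]|[k' /= k'K kx]]; first by right; left.
  by left; left; exists b.
(* A collar not already present has one end on [w] and, as there are no loops, the other on a block
   of [K]; hence it is the collar [i]. *)
have [k'K'|/existsNP[s' /negP s'K]] := pselect (forall s', edge_block k' s' \in K).
  by left; right; exists k'.
have s'w : edge_block k' s' = w by move: (k'K s'); rewrite inE (negbTE s'K) orbF => /set1P.
have s''K : edge_block k' (~~ s') \in K.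
  have /setU1P[s''w|//] := k'K (~~ s').
  have /negP[] := proj1 simple w; apply/dual_graphP; exists k', s'.
  by rewrite s'w s''w.
right; right; rewrite (edge_into_subtree simple tree Kconn wK _ uK s''K) //.
Qed.

(** Take a connected vertex set around [v] of maximal size whose space retracts onto the block; an
    edge leaving it would allow one more extension. The point [x] is the default value of the
    initial map. *)
Lemma graph_manifold_retraction (v : V) (x : block v) :
  dual_graph_simple D -> is_tree (dual_graph D) ->
  (forall w, valence (dual_graph D) w = 1%N ->
    exists j : 'I_(gm_holes w), boundary_component R (boundary_torus j)) ->
  exists2 f : M -> block v, continuous f & forall y, f (set_incl y) = y.
Proof.
move=> simple tree Hend.
pose Q (K : {set V}) := `[< [/\ v \in K,
  {in K &, forall a b, connect (subgraph (dual_graph D) K) a b} &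
  exists2 f : M -> block v, {within subgraph_space K, continuous f} &
    forall y, f (set_incl y) = y] >].
have Q1 : Q [set v]%SET.
  apply/asboolP; split; first by rewrite inE.
    by move=> a b /set1P-> /set1P->; exact: connect0.
  have [f cf fK] := embedding_retraction x (@set_incl_embedding M (block v)).
  exists f => //; apply: continuous_subspaceW cf => y; rewrite range_set_incl.
  case=> [[b /= /set1P-> //]|[i /= iv _]].
  (* A collar with both ends on [v] would be a loop, so the initial space is the block alone. *)
  have /negP[] := proj1 simple v; apply/dual_graphP; exists i, true.
  by have /set1P-> := iv true; have /set1P-> := iv (~~ true).
case: (arg_maxnP (fun K : {set V} => #|K|) Q1) => K /asboolP[vK Kconn [f cf fK]] Kmax.
suff KT w : w \in K.
  exists f => //; apply/continuous_subspace_setT; apply: continuous_subspaceW cf => y _.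
  have [[w wy]|[i iy]] := block_or_collar y; first by left; exists w => //=; exact: KT.
  by right; exists i => // s; exact: KT.
apply: contraT => wK.
have [u [w' [uK w'K uw']]] := connect_exit vK wK (proj1 tree v w).
have [i [s [uE w'E]]] := dual_graphP _ _ uw'.
have Q' : Q (w' |: K).
  apply/asboolP; split; first by rewrite inE vK orbT.
    by apply: (connected_subgraph_extend dual_graph_sym Kconn uK); rewrite dual_graph_sym.
  (* The end [~~ s] is the one on the new block, hence the double negation on the side of [K]. *)
  rewrite w'E in w'K *; have uK' : edge_block i (~~ ~~ s) \in K by rewrite negbK -uE.
  have [f' cf' f'f] := extend_subgraph_map simple tree Hend Kconn w'K uK' cf.
  exists f' => // y; rewrite f'f ?fK //; left; exists v => //; exact: (set_valP y).
by have := Kmax _ Q'; rewrite cardsU1 w'K /= add1n ltnn.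
Qed.

End GraphManifold.

(** * Extending the representation through the retraction *)

Theorem theorem7p1 (R : realType) (M : topologicalType) (D : graph_manifold R M)
    (Hsimple : dual_graph_simple D)
    (Hedge : (0 < #|gm_edge D|)%N)
    (Htree : is_tree (dual_graph D))
    (Hend : forall w : gm_vertex D, valence (dual_graph D) w = 1%N ->
       exists j : 'I_(gm_holes w), boundary_component R (boundary_torus j))
    (v : gm_vertex D) (x : gm_block v)
    (rho0 : {multiplicative pi1 R x -> motion_group R})
    (Hfaithful : injective rho0) :
  exists rho : {multiplicative pi1 R (set_incl x) -> motion_group R},
    forall c : pi1 R x, rho (pi1_map (@set_incl M (gm_block v)) c) = rho0 c.
Proof.
have [f cf fK] := graph_manifold_retraction x Hsimple Htree Hend.
pose F : continuousType M (gm_block v) := mkcts cf.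
have [r rE] := @pi1_map_to R M (gm_block v) F (set_incl x) x (fK x).
(* The retraction fixes loops of the block pointwise, so [r] is a left inverse of the map induced by
   the inclusion. *)
have rc c : r (pi1_map (@set_incl M (gm_block v)) c) = c.
  by rewrite -[RHS](qclass_repr c); apply: rE => t; exact: fK.
pose rho c := rho0 (r c).
have rhoM : {morph rho : c d / (c * d)%g} by move=> c d; rewrite /rho !gmulfM.
pose rhoH : {multiplicative pi1 R (set_incl x) -> motion_group R} :=
  HB.pack rho (isMultiplicative.Build _ _ rho rhoM).
by exists rhoH => c; rewrite -[in RHS](rc c).
Qed.
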